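(* Let $G$ be a countable amenable group and let $(X,T)$ be a $G$-topological dynamical system with the pseudo-orbit tracing property. (i) If $(x,y)\in\mathtt{E}(X,T)$, then $(x,y)\in\overline{\mathtt{A}^{\varepsilon}(X,T)}\setminus\Delta$ for every $\varepsilon>0$, and there exists a $T$-invariant Borel probability measure $\mu$ on $X$ such that $x,y\in\operatorname{supp}(\mu)$. (ii) If $(x,y)\in\mathtt{A}(X,T)$ and there exists a $T$-invariant Borel probability measure $\mu$ on $X$ such that $x,y\in\operatorname{supp}(\mu)$, then $(x,y)\in\mathtt{E}(X,T)\cup\Delta$.
   Context: A $G$-topological dynamical system ($G$-TDS) is a pair $(X,T)$ where $X$ is a compact metric space with metric $d$ and $T:G\times X\to X$ is a left action of $G$ on $X$ by homeomorphisms, $T(g,x)=T^g(x)$. A Følner sequence is a sequence $\{F_n\}$ of finite subsets of $G$ with $|K F_n\,\triangle\, F_n|/|F_n|\to 0$ for every finite $K\subset G$. For an open cover $\mathcal U$ of $X$ and finite $F\subset G$ let $\mathcal U^F=\bigvee_{g\in F}T^{g^{-1}}\mathcal U$, let $N(\mathcal U)$ be the minimum cardinality of a subcover of $\mathcal U$, and let $h_{\mathrm{top}}(T,\mathcal U)=\lim_{n\to\infty}\frac{1}{|F_n|}\log N(\mathcal U^{F_n})$ (independent of the Følner sequence). $\Delta=\{(x,x):x\in X\}$. A pair $(x,y)\in X^2$ is an entropy pair if $x\neq y$ and for every pair of disjoint closed neighborhoods $U_x,U_y$ of $x$ and $y$ one has $h_{\mathrm{top}}(T,\{X\setminus U_x,X\setminus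 U_y\})>0$; $\mathtt{E}(X,T)$ is the set of entropy pairs. For $\varepsilon>0$, $(x,y)$ is $\varepsilon$-asymptotic if there is a finite $F\subset G$ with $d(T^gx,T^gy)\le\varepsilon$ for all $g\notin F$; $\mathtt{A}^\varepsilon(X,T)$ is the set of $\varepsilon$-asymptotic pairs, and $\mathtt{A}(X,T)=\bigcap_{\varepsilon>0}\mathtt{A}^\varepsilon(X,T)$ is the set of asymptotic pairs. Closures are taken in $X^2$. For $\delta>0$ and finite $S\subset G$, an $(S,\delta)$ pseudo-orbit is a family $(x_g)_{g\in G}$ in $X$ with $d(T^sx_g,x_{sg})<\delta$ for all $s\in S$, $g\in G$; it is $\varepsilon$-traced by $x\in X$ if $d(T^gx,x_g)\le\varepsilon$ for all $g\in G$. $(X,T)$ has the pseudo-orbit tracing property (POTP) if for every $\varepsilon>0$ there exist $\delta>0$ and a finite $S\subset G$ such that every $(S,\delta)$ pseudo-orbit is $\varepsilon$-traced by some point of $X$. *)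

(* Defs.v *)
From HB Require Import structures.
From mathcomp Require Import all_boot all_order all_algebra finmap.
From mathcomp Require Import all_classical all_reals all_analysis.

Set Implicit Arguments.
Unset Strict Implicit.
Unset Printing Implicit Defensive.

Import Order.TTheory GRing.Theory Num.Theory.
Import numFieldNormedType.Exports.

Local Open Scope fset_scope.
Local Open Scope classical_set_scope.
Local Open Scope ring_scope.

(* [measurableType] requires a pointed carrier, [metricType] does not provide
   one; a nonempty metric space can be given any point. *)
#[short(type="pmetricType")]
HB.structure Definition PointedMetric (K : numDomainType) :=
  { M of Pointed M & Metric K M }.

(* The existence of such a sequence is amenability. The sets F n are nonempty
   because one divides by their cardinals, and K is nonempty because for
   K = set0 the quotient below is constantly equal to 1. *)
Definition folner (R : realType) (G : groupType) (F : nat -> {fset G}) : Prop :=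
  (forall n, F n != fset0) /\
  forall K : {fset G}, K != fset0 ->
    (fun n => let KF := [fset (k * f)%g | k in K, f in F n]%fset in
      (#|` (KF `\` F n) `|` (F n `\` KF)|%fset)%:R / (#|` F n|)%:R : R)
      @ \oo --> (0 : R).

Section Dynamics.
Variables (R : realType) (G : groupType) (X : pmetricType R) (T : G -> X -> X).

(* Each [T g] is a homeomorphism: its inverse is [T g^-1], also continuous. *)
Record gtds : Prop := Gtds {
  gtds_compact : compact [set: X];
  gtds_act1 : forall x, T 1%g x = x;
  gtds_actM : forall g h x, T (g * h)%g x = T g (T h x);
  gtds_continuous : forall g, continuous (T g) }.

Definition join_cover (F : {fset G}) (U : set (set X)) : set (set X) :=
  [set \bigcap_(g in [set` F]) (T g^-1%g @` A g)
     | A in [set A : G -> set X | forall g, g \in F -> U (A g)]].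

Definition has_subcover (U : set (set X)) (n : nat) : Prop :=
  exists V : set (set X),
    [/\ V `<=` U, \bigcup_(A in V) A = [set: X] & (V #= `I_n)%card].

(* The default 0 is only returned if U has no finite subcover, which does not
   happen for an open cover of a compact space. *)
Definition cover_number (U : set (set X)) : nat :=
  xget 0%N [set n | has_subcover U n /\
                    forall m, has_subcover U m -> (n <= m)%N].

Definition htop (F : nat -> {fset G}) (U : set (set X)) : R :=
  limn (fun n =>
    ln ((cover_number (join_cover (F n) U))%:R : R) / (#|` F n|)%:R).

Definition closed_nbhs (x : X) (U : set X) : Prop := closed U /\ nbhs x U.

Definition entropy_pairs (F : nat -> {fset G}) : set (X * X) :=
  [set p | p.1 <> p.2 /\
    forall Ux Uy : set X, closed_nbhs p.1 Ux -> closed_nbhs p.2 Uy ->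
      Ux `&` Uy = set0 -> 0 < htop F [set ~` Ux; ~` Uy]].

Definition eps_asymptotic_pairs (e : R) : set (X * X) :=
  [set p | exists F : {fset G},
    forall g, g \notin F -> mdist (T g p.1) (T g p.2) <= e].

Definition asymptotic_pairs : set (X * X) :=
  \bigcap_(e in [set e : R | 0 < e]) eps_asymptotic_pairs e.

Definition pseudo_orbit (S : {fset G}) (delta : R) (o : G -> X) : Prop :=
  forall s g, s \in S -> mdist (T s (o g)) (o (s * g)%g) < delta.

Definition traced (e : R) (o : G -> X) (x : X) : Prop :=
  forall g, mdist (T g x) (o g) <= e.

Definition potp : Prop :=
  forall e : R, 0 < e -> exists2 delta : R, 0 < delta &
    exists S : {fset G}, forall o : G -> X,
      pseudo_orbit S delta o -> exists x, traced e o x.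

Definition borel : Type := g_sigma_algebraType (@open X).
HB.instance Definition _ := Measurable.on borel.

Definition invariant_measure (mu : probability borel R) : Prop :=
  forall g (A : set borel), measurable A -> mu (T g @^-1` A) = mu A.

Definition measure_support (mu : probability borel R) : set X :=
  [set x | forall U : set X, open U -> U x -> (0 < mu U)%E].

End Dynamics.

(* Main.v *)
Require Import Defs.
From HB Require Import structures.
From mathcomp Require Import all_boot all_order all_algebra finmap.
From mathcomp Require Import all_classical all_reals all_analysis.
From mathcomp Require Import measurable_realfun ring lra.

(** Everything rests on counting itineraries along a Folner sequence F_n.
    Fix disjoint closed neighbourhoods Ux, Uy of two points and let N_n be the
    least number of sets of the join of {~Ux, ~Uy} over F_n that cover X; a
    set of points is contained in a single set of the join unless, at some time
    of F_n, it has a point in Ux and another one in Uy.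

    The entropy is the limit of ln N_n / |F_n|, so that statements on its sign
    need the limit to exist. It does because ln N is subadditive and does not
    increase under right translation ([ornstein_weiss]): if the infimum L of
    the ratios that bound f asymptotically were not approached by f (F_n), one
    could fill a fixed fraction of every almost invariant set with almost
    disjoint translates of one F_n of smaller ratio; what remains is still
    almost invariant, and L would not be the infimum.

    Entropy pairs are limits of pairs that are asymptotic up to a given
    precision ([entropy_asymptotic]). Read approximately, the orbits restricted
    to the S-boundary of F_n fall into exp(o(|F_n|)) classes, fewer than N_n.
    Hence some class contains p and q, and F_n contains g, with T g p in Ux and
    T g q in Uy. Following q on F_n and p elsewhere is a pseudo-orbit, since p
    and q agree along the boundary; a point tracing it is asymptotic to p, up
    to the precision, and goes near Uy at time g.

    Entropy pairs lie in the support of an invariant measure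
    ([entropy_pair_support]). If every orbit visited Ux for a small proportion
    of the times in F_n only, the sets of visiting times would be exponentially
    few and would bound N_n. So there are points z_n that visit Ux with
    frequency at least a > 0. The limits of these frequencies along an
    ultrafilter form a finitely additive invariant mean with value at least a
    on Ux; its outer regularization is a Borel measure that gives closed sets
    no less than the mean does ([measure_of_mean]). A mixture over a sequence
    of shrinking neighbourhoods charges them all.

    Conversely ([asymptotic_entropy]), if x is in the support of an invariant
    measure, integrating the number of visits gives a point z that meets a
    small neighbourhood of x at a positive proportion of the times in F_n, and
    a positive proportion of these times is well separated. Around each of them
    one may follow the orbit of y, asymptotic to x, in place of that of z. The
    independent choices are pseudo-orbits, and tracing them yields points with
    pairwise distinct itineraries, exponentially many in |F_n|. *)

Set Implicit Arguments.
Unset Strict Implicit.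
Unset Printing Implicit Defensive.

Import Order.TTheory GRing.Theory Num.Theory.
Import numFieldNormedType.Exports.

Local Open Scope fset_scope.
Local Open Scope classical_set_scope.
Local Open Scope ring_scope.

(** * Products, boundaries and almost disjoint translates of finite sets *)

Section FinitePartsOfGroup.
Local Open Scope fset_scope.
Variable G : groupType.
Implicit Types (K C D U I : {fset G}).

Definition mulfs K D : {fset G} := [fset (k * f)%g | k in K, f in D].

Lemma mulfsP K D x :
  reflect (exists2 k, k \in K & exists2 f, f \in D & x = (k * f)%g)
          (x \in mulfs K D).
Proof. exact: imfset2P. Qed.

Lemma mem_mulfs K D k f : k \in K -> f \in D -> (k * f)%g \in mulfs K D.
Proof. by move=> kK fD; apply/mulfsP; exists k => //; exists f. Qed.

Lemma mulfs1E K c : mulfs K [fset c] = [fset (k * c)%g | k in K]%fset.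
Proof.
apply/fsetP => x; apply/mulfsP/imfsetP => /=.
  by move=> [k kK [f]]; rewrite inE => /eqP -> ->; exists k.
by move=> [k kK ->]; exists k => //; exists c => //; rewrite inE.
Qed.

Lemma card_mulfs1 K c : #|` mulfs K [fset c]| = #|` K|.
Proof. by rewrite mulfs1E card_imfset//; exact: mulIg. Qed.

Lemma mulfs0 K : mulfs K fset0 = fset0.
Proof. by apply/fsetP => x; rewrite inE; apply/mulfsP => -[k _ [f]]. Qed.

Lemma mulfsU1 K c C : mulfs K (c |` C) = mulfs K [fset c] `|` mulfs K C.
Proof.
apply/fsetP => x; rewrite inE; apply/mulfsP/orP.
  move=> [k kK [f]]; rewrite !inE => /orP[/eqP -> ->|fC ->].
    by left; apply: mem_mulfs => //; rewrite inE.
  by right; apply: mem_mulfs.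
move=> [] /mulfsP[k kK [f fC ->]]; exists k => //; exists f => //.
  by move: fC; rewrite !inE => ->.
by rewrite !inE fC orbT.
Qed.

Lemma card_mulfs_le K D : (#|` mulfs K D| <= #|` K| * #|` D|)%N.
Proof.
elim/fset1U_rect: D => [|c D cD IH]; first by rewrite mulfs0 cardfs0.
rewrite mulfsU1 cardfsU1 cD mulnS.
by rewrite (leq_trans (leq_card_fsetU _ _).1)// card_mulfs1 leq_add2l.
Qed.

Lemma card_fsetI_sum D U : #|` D `&` U| = (\sum_(u <- U) (u \in D))%N.
Proof.
rewrite card_fset_sum1.
have -> : D `&` U = [fset u in U | u \in D]%fset.
  by apply/fsetP => u; rewrite !inE andbC.
by rewrite big_fset /= big_mkcond; apply: eq_bigr => u _; case: (u \in D).
Qed.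

(** Counting the pairs (c, u) with u in K c from the side of u: a point of U
    lies in at most #|K| translates K c. *)
Lemma double_counting K I U :
  (\sum_(c <- I) #|` mulfs K [fset c] `&` U| <= #|` K| * #|` U|)%N.
Proof.
under eq_bigr do rewrite card_fsetI_sum.
rewrite exchange_big /=.
apply: (@leq_trans (\sum_(u <- U) #|` K|)%N); last first.
  by rewrite (card_fset_sum1 U) big_distrr /=; under eq_bigr do rewrite -[#|`K|]muln1.
apply: leq_sum => u _.
have -> : (\sum_(c <- I) (u \in mulfs K [fset c]) =
  \sum_(c <- I) (c \in [fset (k^-1 * u)%g | k in K]%fset))%N.
  apply: eq_bigr => c _; congr (nat_of_bool _); rewrite mulfs1E.
  apply/imfsetP/imfsetP => /= -[k kK ->]; exists k => //.
    by rewrite mulKg.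
  by rewrite mulVKg.
rewrite -card_fsetI_sum.
apply: leq_trans (fsubset_leq_card (fsubsetIl _ _)) _.
exact: leq_imfset_card.
Qed.

Definition inner_boundary K D : {fset G} :=
  [fset c in D | ~~ (mulfs K [fset c] `<=` D)].

Lemma inner_boundaryP K D c :
  reflect (c \in D /\ exists2 k, k \in K & (k * c)%g \notin D)
  (c \in inner_boundary K D).
Proof.
rewrite /inner_boundary !inE; apply: (iffP andP) => -[cD] /=; rewrite mulfs1E.
  move=> /fsubsetPn[x /imfsetP[k /= kK ->] kcD]; split=> //.
  by exists k.
move=> [k kK kcD]; split => //; apply/fsubsetPn; exists (k * c)%g => //.
by apply/imfsetP; exists k.
Qed.

Definition invfs K : {fset G} := [fset k^-1%g | k in K]%fset.

Lemma mem_invfs K k : k \in K -> k^-1%g \in invfs K.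
Proof. by move=> kK; apply/imfsetP; exists k. Qed.

Lemma card_invfs K : (#|` invfs K| <= #|` K|)%N.
Proof. exact: leq_imfset_card. Qed.

Lemma inner_boundary_sub K D :
  inner_boundary K D `<=` mulfs (invfs K) (mulfs K D `\` D).
Proof.
apply/fsubsetP => c /inner_boundaryP[cD [k kK kc]].
rewrite -[c](mulKg k); apply: mem_mulfs; first exact: mem_invfs.
by rewrite inE kc mem_mulfs.
Qed.

Lemma card_inner_boundary K D :
  (#|` inner_boundary K D| <= #|` K| * #|` mulfs K D `\` D|)%N.
Proof.
apply: leq_trans (fsubset_leq_card (inner_boundary_sub K D)) _.
apply: leq_trans (card_mulfs_le _ _) _.
by rewrite leq_mul2r card_invfs orbT.
Qed.

(** Carving the tiles K1 c out of D creates new boundary only near the tiles,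
    in a proportion that depends on how invariant K1 is under the inverse of
    K, and not on the shape of what has been carved. *)
Lemma inner_boundary_fsetD K K1 C D :
  inner_boundary K (D `\` mulfs K1 C) `<=`
  inner_boundary K D `|` mulfs (mulfs (invfs K) K1 `\` K1) C.
Proof.
apply/fsubsetP => c /inner_boundaryP[]; rewrite inE => /andP[cU cD] [k kK].
rewrite in_fsetD negb_and negbK in_fsetU => /orP[|kcD]; last first.
  by apply/orP; left; apply/inner_boundaryP; split => //; exists k.
move=> /mulfsP[k1 k1K [c1 c1C kc]]; apply/orP; right.
have ce : c = (k^-1 * k1 * c1)%g by rewrite -mulgA -kc mulKg.
rewrite ce; apply: mem_mulfs => //; rewrite inE mem_mulfs ?mem_invfs// andbT.
by apply: contra cU => kk1; rewrite ce mem_mulfs.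
Qed.

(** Translates of K with small overlaps fill a fraction eps of D: a maximal
    family with |K C| >= (1 - eps) |K| |C| works, because every translate that
    fits inside D must meet the union in a fraction eps of K, and these
    intersections are controlled by double counting. The overlap condition
    bears on the union alone, which spares an order on the tiles. *)
Lemma filling (R : realType) (eps : R) K D : 0 <= eps -> eps <= 1 ->
  K != fset0 ->
  exists C, [/\ mulfs K C `<=` D,
    (1 - eps) * (#|` K|%:R * #|` C|%:R) <= #|` mulfs K C|%:R &
    eps * (#|` D|%:R - #|` inner_boundary K D|%:R) <= #|` mulfs K C|%:R :> R].
Proof.
move=> eps0 eps1 K0.
pose I := D `\` inner_boundary K D.
have IP c : c \in I -> mulfs K [fset c] `<=` D.
  rewrite inE => /andP[cb cD]; apply/fsubsetP => x.
  rewrite mulfs1E => /imfsetP[k /= kK ->].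
  by apply: contraNT cb => kc; apply/inner_boundaryP; split => //; exists k.
pose good C := C `<=` I /\
  (1 - eps) * (#|` K|%:R * #|` C|%:R) <= #|` mulfs K C|%:R :> R.
have good0 : good fset0.
  by split; [exact: fsub0set | rewrite mulfs0 !cardfs0 !mulr0].
pose P n := `[< exists2 C, good C & #|` C| = n >].
have exP : exists n, P n by exists 0%N; apply/asboolP; exists fset0.
have bP n : P n -> (n <= #|` I|)%N.
  by move=> /asboolP[C [CI _] <-]; exact: fsubset_leq_card.
case: (ex_maxnP exP bP) => n /asboolP[C [CI gC] Cn] nmax.
have K0R : 0 < #|` K|%:R :> R by rewrite ltr0n cardfs_gt0.
exists C; split => //.
  apply/fsubsetP => x /mulfsP[k kK [c cC ->]].
  move/fsubsetP : CI => /(_ c cC) /IP /fsubsetP; apply.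
  by apply: mem_mulfs => //; rewrite inE.
set U := mulfs K C.
(* otherwise c could be added to C *)
have Imax c : c \in I -> eps * #|` K|%:R <= #|` mulfs K [fset c] `&` U|%:R.
  move=> cI; have [cC|cC] := boolP (c \in C).
    have -> : mulfs K [fset c] `&` U = mulfs K [fset c].
      apply/fsetIidPl/fsubsetP => x /mulfsP[k kK [f]]; rewrite inE => /eqP -> ->.
      exact: mem_mulfs.
    by rewrite card_mulfs1 ler_piMl// ltW.
  rewrite leNgt; apply/negP => lt.
  have : P n.+1.
    apply/asboolP; exists (c |` C); last by rewrite cardfsU1 cC Cn.
    split; first by rewrite fsubUset fsub1set cI.
    have := cardfsUI (mulfs K [fset c]) U.
    rewrite mulfsU1 cardfsU1 cC card_mulfs1 -/U => /(congr1 (fun m => m%:R : R)).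
    rewrite !natrD /= mulrDr mulr1; lra.
  by move=> /nmax; rewrite ltnn.
have : eps * #|` K|%:R * #|` I|%:R <= #|` K|%:R * #|` U|%:R.
  pose S := (\sum_(c <- I) #|` mulfs K [fset c] `&` U|)%N.
  rewrite -natrM; apply: (@le_trans _ _ S%:R); last first.
    by rewrite ler_nat double_counting.
  rewrite (card_fset_sum1 I) /S !natr_sum mulr_sumr big_seq [leRHS]big_seq.
  by apply: ler_sum => c cI; rewrite mulr1 Imax.
have -> : #|` I|%:R = #|` D|%:R - #|` inner_boundary K D|%:R :> R.
  rewrite /I cardfsDS ?natrB ?fsubset_leq_card//;
    by apply/fsubsetP => c /inner_boundaryP[].
by rewrite (mulrC eps) -mulrA ler_pM2l.
Qed.

End FinitePartsOfGroup.

(** * Convergence of subadditive functions along a Folner sequence *)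

Section OrnsteinWeiss.
Variables (R : realType) (G : groupType) (F : nat -> {fset G}).
Hypothesis folnerF : folner R F.

Lemma folner_card_gt0 n : 0 < #|` F n|%:R :> R.
Proof. by rewrite ltr0n cardfs_gt0 folnerF.1. Qed.

(** The empty K is included: enlarging K by the identity makes it
    nonempty, as the Folner condition requires. *)
Lemma folner_mulfsD (K : {fset G}) (eta : R) : 0 < eta ->
  \forall n \near \oo, #|` (mulfs K (F n) `\` F n)%fset|%:R <= eta * #|` F n|%:R.
Proof.
move=> eta0; have K1 : (1%g |` K)%fset != fset0.
  by apply/fset0Pn; exists 1%g; rewrite !inE eqxx.
have /cvgrPdist_le/(_ _ eta0) := folnerF.2 _ K1; apply: filterS => n /=.
rewrite sub0r normrN -/(mulfs _ _) ger0_norm ?divr_ge0//.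
rewrite ler_pdivrMr ?folner_card_gt0//; apply: le_trans.
rewrite ler_nat fsubset_leq_card//; apply/fsubsetP => x.
rewrite !inE => /andP[xF /mulfsP[k kK [f fF xE]]]; rewrite xF/= xE mem_mulfs//.
by rewrite !inE kK orbT.
Qed.

Lemma folner_inner_boundary (K : {fset G}) (eta : R) : 0 < eta ->
  \forall n \near \oo, #|` inner_boundary K (F n)|%:R <= eta * #|` F n|%:R.
Proof.
move=> eta0; have K0 : 0 < #|` K|.+1%:R :> R by [].
have := @folner_mulfsD K (eta / #|` K|.+1%:R) (divr_gt0 eta0 K0).
apply: filterS => n le.
apply: (@le_trans _ _ (#|` K|.+1%:R * #|` (mulfs K (F n) `\` F n)%fset|%:R)).
  rewrite -natrM ler_nat (leq_trans (card_inner_boundary _ _))//.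
  by rewrite leq_mul2r leqnSn orbT.
rewrite -ler_pdivlMl//; apply: le_trans le _.
by rewrite mulrAC mulrC mulrA.
Qed.

Variable f : {fset G} -> R.
Hypotheses (f0 : f fset0 = 0) (f_ge0 : forall A, 0 <= f A)
  (fU : forall A B, f (A `|` B)%fset <= f A + f B)
  (fM : forall A c, f (mulfs A [fset c]) <= f A).

Lemma subadditive_le_card A : f A <= f [fset 1%g] * #|` A|%:R.
Proof.
elim/fset1U_rect: A => [|c A cA IH]; first by rewrite f0 cardfs0 mulr0.
rewrite (le_trans (fU _ _))// cardfsU1 cA natrD mulrDr mulr1 lerD//.
by apply: le_trans (fM _ c); rewrite mulfs1E imfset_fset1 mul1g.
Qed.

Lemma subadditive_mulfs K C : f (mulfs K C) <= f K * #|` C|%:R.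
Proof.
elim/fset1U_rect: C => [|c C cC IH].
  by rewrite mulfs0 f0 cardfs0 mulr0.
by rewrite mulfsU1 (le_trans (fU _ _))// cardfsU1 cC natrD mulrDr mulr1 lerD.
Qed.

(** r bounds f D / #|D| for all sufficiently invariant D, and not only for
    the F n: the sets left over by a filling are of the first kind only. *)
Definition asymptotic_bound (r : R) : Prop :=
  exists (K : {fset G}) (eta : R), 0 < eta /\
    forall D, D != fset0 -> #|` inner_boundary K D|%:R <= eta * #|` D|%:R ->
      f D <= r * #|` D|%:R.

Lemma le_asymptotic_bound r s : r <= s -> asymptotic_bound r -> asymptotic_bound s.
Proof.
move=> rs [K [eta [eta0 b]]]; exists K, eta; split=> // D D0 /(b _ D0) h.
by rewrite (le_trans h)// ler_wpM2r.
Qed.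

Lemma asymptotic_bound_folner r : asymptotic_bound r ->
  \forall n \near \oo, f (F n) <= r * #|` F n|%:R.
Proof.
move=> [K [eta [eta0 b]]]; apply: filterS (folner_inner_boundary K eta0) => n.
exact/b/folnerF.1.
Qed.

Lemma inner_boundary_fsetU (K K' D : {fset G}) :
  (inner_boundary K D `<=` inner_boundary (K `|` K') D)%fset.
Proof.
apply/fsubsetP => c /inner_boundaryP[cD [k kK kc]]; apply/inner_boundaryP; split => //.
by exists k => //; rewrite inE kK.
Qed.

(** One step of the filling argument. On the tiled part U of D, which has at
    least eps / 2 of the points of D, the ratio of f drops from r to a; on the
    rest D' it is still at most r, unless D' has fewer than eps #|D| points, in
    which case it costs at most f [fset 1] per point. The factor 1 - eps in the
    assumption on f K1 compensates for the overlaps of the tiles. *)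
Lemma improve_bound (K : {fset G}) eta r (K1 : {fset G}) a eps :
  0 < eta -> 0 < eps -> eps <= 1 / 2 -> 0 <= a -> a <= r ->
  (forall D, D != fset0 -> #|` inner_boundary K D|%:R <= eta * #|` D|%:R ->
      f D <= r * #|` D|%:R) ->
  K1 != fset0 -> f K1 <= (1 - eps) * a * #|` K1|%:R ->
  #|` (mulfs (invfs K) K1 `\` K1)%fset|%:R <=
    eta * eps / 2 * (1 - eps) * #|` K1|%:R ->
  asymptotic_bound
    (Num.max (a + f [fset 1%g] * eps) (r - eps / 2 * (r - a))).
Proof.
move=> eta0 eps0 epsh a0 ar bnd K10 fK1 invK1.
set M := f [fset 1%g]; set s := Num.max _ _.
exists (K1 `|` K)%fset, (Num.min (1 / 2) (eta * eps / 2)); split.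
  by rewrite lt_min !divr_gt0// mulr_gt0.
move=> D D0 bD.
have D0R : 0 < #|` D|%:R :> R by rewrite ltr0n cardfs_gt0.
have K0R : 0 < #|` K1|%:R :> R by rewrite ltr0n cardfs_gt0.
have bD1 : #|` inner_boundary K1 D|%:R <= 1 / 2 * #|` D|%:R :> R.
  apply: le_trans (le_trans bD _).
    by rewrite ler_nat fsubset_leq_card// inner_boundary_fsetU.
  by rewrite ler_wpM2r// ge_min lexx.
have bDK : #|` inner_boundary K D|%:R <= eta * eps / 2 * #|` D|%:R :> R.
  apply: le_trans (le_trans bD _).
    by rewrite ler_nat fsubset_leq_card// fsetUC inner_boundary_fsetU.
  by rewrite ler_wpM2r// ge_min lexx orbT.
have eps1 : eps <= 1 by lra.
have [C [KCD KC1 KC2]] := filling D (ltW eps0) eps1 K10.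
set U := mulfs K1 C in KCD KC1 KC2.
have fU' : f U <= a * #|` U|%:R.
  apply: le_trans (subadditive_mulfs K1 C) _.
  apply: (@le_trans _ _ (a * ((1 - eps) * (#|` K1|%:R * #|` C|%:R)))); last first.
    by rewrite ler_wpM2l.
  have -> : a * ((1 - eps) * (#|` K1|%:R * #|` C|%:R)) =
    (1 - eps) * a * #|` K1|%:R * #|` C|%:R by rewrite !mulrA (mulrC a).
  by rewrite ler_wpM2r.
set D' := (D `\` U)%fset.
have DE : #|` D|%:R = #|` U|%:R + #|` D'|%:R :> R.
  by rewrite -natrD /D' cardfsDS// subnKC// fsubset_leq_card.
have fD : f D <= f U + f D'.
  rewrite (_ : D = (U `|` D')%fset) ?(le_trans (fU _ _))//.
  apply/fsetP => x; rewrite !inE; case: (boolP (x \in U)) => //= xU.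
  by move/fsubsetP : KCD => ->.
have Ug : eps / 2 * #|` D|%:R <= #|` U|%:R.
  apply: le_trans KC2; rewrite -mulrA ler_wpM2l ?(ltW eps0)//; lra.
have U0 : 0 <= #|` U|%:R :> R by [].
have D'0 : 0 <= #|` D'|%:R :> R by [].
have [D'le|D'gt] := leP #|` D'|%:R (eps * #|` D|%:R).
  apply: (@le_trans _ _ ((a + M * eps) * #|` D|%:R)); last first.
    by rewrite ler_wpM2r// le_max lexx.
  have M0 : 0 <= M by exact: f_ge0.
  have := ler_wpM2l M0 D'le.
  have := subadditive_le_card D'; rewrite -/M mulrDl.
  have : a * #|` U|%:R <= a * #|` D|%:R by rewrite ler_wpM2l// DE; lra.
  rewrite mulrA; lra.
have D'n0 : D' != fset0.
  rewrite -cardfs_gt0 -(@ltr0n R); apply: le_lt_trans D'gt.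
  by rewrite mulr_ge0// ltW.
have bD' : #|` inner_boundary K D'|%:R <= eta * #|` D'|%:R :> R.
  apply: (@le_trans _ _ (#|` inner_boundary K D|%:R +
      #|` (mulfs (invfs K) K1 `\` K1)%fset|%:R * #|` C|%:R)).
    rewrite -natrM -natrD ler_nat.
    apply: leq_trans (fsubset_leq_card (inner_boundary_fsetD _ _ _ _)) _.
    rewrite (leq_trans (leq_card_fsetU _ _).1)// leq_add2l.
    exact: card_mulfs_le.
  apply: (@le_trans _ _ (eta * (eps * #|` D|%:R))); last first.
    by rewrite ler_pM2l// ltW.
  have e1 : #|` (mulfs (invfs K) K1 `\` K1)%fset|%:R * #|` C|%:R <=
      eta * eps / 2 * (1 - eps) * #|` K1|%:R * #|` C|%:R :> R.
    by rewrite ler_wpM2r.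
  have e2 : eta * eps / 2 * ((1 - eps) * (#|` K1|%:R * #|` C|%:R)) <=
     eta * eps / 2 * #|` D|%:R.
    rewrite ler_wpM2l//; first by rewrite divr_ge0// mulr_ge0// ltW.
    by rewrite (le_trans KC1)// DE lerDl.
  move: e1 e2; rewrite !mulrA; lra.
apply: (@le_trans _ _ ((r - eps / 2 * (r - a)) * #|` D|%:R)); last first.
  by rewrite ler_wpM2r// le_max lexx orbT.
have := bnd _ D'n0 bD'.
have ra : 0 <= r - a by rewrite subr_ge0.
have := ler_wpM2l ra Ug.
have -> : #|` D'|%:R = #|` D|%:R - #|` U|%:R :> R by rewrite DE; lra.
rewrite !mulrBl !mulrBr; lra.
Qed.

(** Let L be the infimum of the asymptotic bounds. Eventually the ratio is at
    most L + e by definition; were it below L - e for some n with F n invariant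
    enough, tiling with F n would improve a bound close to L into one below
    L. *)
Theorem ornstein_weiss : cvgn (fun n => f (F n) / #|` F n|%:R).
Proof.
set M := f [fset 1%g]; have M0 : 0 <= M by exact: f_ge0.
have bM : asymptotic_bound M.
  by exists fset0, 1; split=> // D _ _; exact: subadditive_le_card.
have b_ge0 r : asymptotic_bound r -> 0 <= r.
  move=> /asymptotic_bound_folner [n _ /(_ n (leqnn n)) /= h].
  have := le_trans (f_ge0 _) h.
  by rewrite pmulr_lge0// folner_card_gt0.
have hinf : has_inf [set r | asymptotic_bound r].
  by split; [exists M | exists 0 => r /b_ge0].
pose L := inf [set r | asymptotic_bound r].
have L0 : 0 <= L by apply: lb_le_inf => [|r /b_ge0//]; exists M.
have LM : L <= M by apply: ge_inf => //; exact: hinf.2.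
have Linf r : asymptotic_bound r -> L <= r.
  by move=> br; apply: ge_inf => //; exact: hinf.2.
have Ladh e : 0 < e -> asymptotic_bound (L + e).
  move=> e0; have [r br rL] := inf_adherent e0 hinf.
  exact: le_asymptotic_bound (ltW rL) br.
apply/cvg_ex; exists L; apply/cvgrPdist_le => e e0.
have up := asymptotic_bound_folner (Ladh _ e0).
suff lo : \forall n \near \oo, (L - e) * #|` F n|%:R <= f (F n).
  apply: filterS2 up lo => n up lo.
  rewrite -ler_pdivrMr ?folner_card_gt0// in up.
  rewrite -ler_pdivlMr ?folner_card_gt0// in lo.
  by rewrite ler_norml; apply/andP; split; lra.
have [Le|Le] := leP (L - e) 0.
  by apply: nearW => n; rewrite (le_trans _ (f_ge0 _))// mulr_le0_ge0.
(* eps makes the cost M eps of a small remainder, and the loss due to the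
   overlaps of the tiles, at most e / 4 each *)
pose eps := Num.min (1 / 2) (e / (4 * (M + 1))).
have M10 : 0 < 4 * (M + 1) by rewrite mulr_gt0// ltr_wpDl.
have eps0 : 0 < eps by rewrite lt_min !divr_gt0.
have epsh : eps <= 1 / 2 by rewrite ge_min lexx.
have epsM : M * eps + eps <= e / 4.
  have : eps <= e / (4 * (M + 1)) by rewrite ge_min lexx orbT.
  rewrite ler_pdivlMr//; lra.
(* a bound so close to L that one step, which gains at least
   eps e / 4, goes below L *)
have e80 : 0 < eps * e / 8 by rewrite divr_gt0// mulr_gt0.
have [K [eta [eta0 bnd]]] := Ladh _ e80.
pose theta := eta * eps / 2 * (1 - eps).
have theta0 : 0 < theta by rewrite !mulr_gt0//; lra.
apply: filterS (folner_mulfsD (invfs K) theta0) => n inv.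
rewrite leNgt; apply/negP => lt.
have eLM : eps * (L - e / 2) <= e / 4.
  apply: le_trans epsM; rewrite (mulrC M).
  have : eps * (L - e / 2) <= eps * M by rewrite ler_pM2l//; lra.
  lra.
have ee : 0 < eps * e by rewrite mulr_gt0.
have [] // := @improve_bound K eta (L + eps * e / 8) (F n) (L - e / 2) eps
  eta0 eps0 epsh _ _ bnd (folnerF.1 n) _ inv.
- lra.
- lra.
- rewrite (le_trans (ltW lt))// ler_wpM2r//; lra.
move=> K' [eta' b'].
have /Linf : asymptotic_bound (Num.max (L - e / 2 + M * eps)
  (L + eps * e / 8 - eps / 2 * (L + eps * e / 8 - (L - e / 2)))).
  by exists K', eta'.
rewrite le_max leNgt => /orP[/negP|]; first by apply; lra.
apply/negP; rewrite -ltNge.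
have : 0 <= eps * (eps * e) by rewrite ltW// mulr_gt0.
lra.
Qed.

End OrnsteinWeiss.

(** * Cover numbers and the existence of the entropy *)

Section CoverNumber.
Variables (R : realType) (X : pmetricType R).
Implicit Types U : set (set X).

Lemma has_subcoverP U n : has_subcover U n ->
  exists P : 'I_n -> set X, (forall i, U (P i)) /\ forall x, exists i, P i x.
Proof.
move=> [V [VU Vcov]]; rewrite card_eq_sym => /card_set_bijP[h [hV _ hs]].
exists (fun i => h i); split=> [i|x]; first by apply/VU/hV => /=.
have : (\bigcup_(A in V) A) x by rewrite Vcov.
by move=> [A /hs[k /= kn <-] hkx]; exists (Ordinal kn).
Qed.

(** The default value is never reached once some finite subcover exists. *)
Lemma cover_number_min U n : has_subcover U n ->
  has_subcover U (cover_number U) /\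
  forall m, has_subcover U m -> (cover_number U <= m)%N.
Proof.
move=> Un; rewrite /cover_number; case: xgetP => [k -> //|none]; exfalso.
have ex : exists m, `[< has_subcover U m >] by exists n; apply/asboolP.
case: (ex_minnP ex) => m /asboolP Um mmin; apply: (none m); split=> // k Uk.
by apply: mmin; apply/asboolP.
Qed.

(** Upper bounds on the cover number come from covers by pieces that need
    not belong to U. *)
Lemma cover_number_le U (I : finType) (P : I -> set X) :
  (forall x, exists i, P i x) -> (forall i, exists2 u, U u & P i `<=` u) ->
  has_subcover U (cover_number U) /\ (cover_number U <= #|I|)%N.
Proof.
move=> Pcov PU.
have /choice[u uP] : forall i, exists u, U u /\ P i `<=` u.
  by move=> i; have [u Uu Pu] := PU i; exists u.
pose V := [fset u i | i in I]%fset.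
have cV : has_subcover U #|` V|.
  exists [set` V]; split.
  - by move=> _ /= /imfsetP[i _ ->]; exact: (uP i).1.
  - rewrite eqEsubset; split => // x _; have [i Pix] := Pcov x.
    by exists (u i) => /=; [apply/imfsetP; exists i | exact: (uP i).2].
  - exact/card_eq_fsetP.
have [h1 h2] := cover_number_min cV; split => //.
apply: leq_trans (h2 _ cV) _; rewrite cardE.
apply: leq_trans (leq_imfset_card _ _ _) _ => /=.
by [].
Qed.

Lemma cover_number_ge U (I : finType) (w : I -> X) :
  has_subcover U (cover_number U) ->
  (forall u i j, U u -> u (w i) -> u (w j) -> i = j) ->
  (#|I| <= cover_number U)%N.
Proof.
move=> /has_subcoverP[P [PU Pcov]] sep.
have [k kP] := choice (fun i => Pcov (w i)).
rewrite -[leqRHS]card_ord; apply: (@leq_card _ _ k) => i j kij.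
by apply: (sep (P (k i))) => //; rewrite kij.
Qed.

Lemma cover_number_gt0 U : has_subcover U (cover_number U) ->
  (0 < cover_number U)%N.
Proof.
move=> /has_subcoverP[P [_ /(_ point)[i _]]].
by apply: leq_ltn_trans (ltn_ord i).
Qed.

End CoverNumber.

Section JoinCover.
Variables (R : realType) (G : groupType) (X : pmetricType R) (T : G -> X -> X).
Hypothesis T_gtds : gtds T.
Implicit Types (F : {fset G}) (A B : set X).

Lemma gtds_actK g : cancel (T g) (T g^-1%g).
Proof. by move=> x; rewrite -gtds_actM// mulVg gtds_act1. Qed.

Lemma gtds_actVK g : cancel (T g^-1%g) (T g).
Proof. by move=> x; rewrite -gtds_actM// mulgV gtds_act1. Qed.

Lemma image_actV g A : T g^-1%g @` A = T g @^-1` A.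
Proof.
rewrite eqEsubset; split => x /=.
  by move=> [y Ay <-]; rewrite gtds_actVK.
by move=> Ax; exists (T g x) => //; rewrite gtds_actK.
Qed.

(** The members of the join are the sets of points whose itinerary over F
    follows a given sequence of members of U. *)
Lemma join_coverE F (U : set (set X)) (u : set X) : join_cover T F U u <->
  exists2 a : G -> set X, (forall g, g \in F -> U (a g)) &
    u = [set x | forall g, g \in F -> a g (T g x)].
Proof.
have E (a : G -> set X) : \bigcap_(g in [set` F]) (T g^-1%g @` a g) =
    [set x | forall g, g \in F -> a g (T g x)].
  rewrite eqEsubset; split => x h g gF.
    by have := h _ gF; rewrite image_actV.
  by rewrite image_actV; exact: h.
split=> [[a aU <-]|[a aU ->]]; first by exists a => //; exact: E.
by exists a => //; exact: E.
Qed.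

Variables A B : set X.
Hypothesis AB : A `|` B = setT.

Let N F := cover_number (join_cover T F [set A; B]).

(** Choosing A whenever possible gives at most 2 ^ #|F| itinerary sets that
    cover X. *)
Lemma join_has_subcover F :
  has_subcover (join_cover T F [set A; B]) (N F).
Proof.
pose c (i : {ffun F -> bool}) := fun g : G =>
  if insub g is Some h then (if i h then A else B) else A.
pose P (i : {ffun F -> bool}) := [set x | forall g, g \in F -> c i g (T g x)].
apply: (@cover_number_le _ _ _ _ P _ _).1.
- move=> x; exists [ffun h : F => `[< A (T (val h) x) >]] => g gF.
  rewrite /c insubT /= ffunE /=; case: asboolP => // nA.
  by have : (A `|` B) (T g x) by [rewrite AB]; case.
- move=> i; exists (P i) => //; apply/join_coverE; exists (c i) => // g gF.
  by rewrite /c insubT; case: ifP => _; [left|right].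
Qed.

Lemma join_number_gt0 F : (0 < N F)%N.
Proof. exact/cover_number_gt0/join_has_subcover. Qed.

Lemma join_number_le F (I : finType) (P : I -> set X) :
  (forall x, exists i, P i x) ->
  (forall i g, g \in F ->
    (forall x, P i x -> A (T g x)) \/ (forall x, P i x -> B (T g x))) ->
  (N F <= #|I|)%N.
Proof.
move=> Pcov PAB; apply: (@cover_number_le _ _ _ _ P _ _).2 => // i.
pose a g := if pselect (forall x, P i x -> A (T g x)) then A else B.
exists [set x | forall g, g \in F -> a g (T g x)].
  apply/join_coverE; exists a => // g gF; rewrite /a.
  by case: pselect => ? /=; [left|right].
move=> x Pix g gF; rewrite /a; case: pselect => [h|nA]; first exact: h.
by have [/nA//|h] := PAB i g gF; apply: h.
Qed.

Lemma join_number0 : N fset0 = 1%N.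
Proof.
apply/eqP; rewrite eqn_leq join_number_gt0 andbT -card_unit.
by apply: (@join_number_le _ _ (fun=> setT)) => // x; exists tt.
Qed.

Lemma join_numberU F1 F2 : (N (F1 `|` F2)%fset <= N F1 * N F2)%N.
Proof.
have [P [P1 Pc]] := has_subcoverP (join_has_subcover F1).
have [Q [Q1 Qc]] := has_subcoverP (join_has_subcover F2).
rewrite -[leqRHS](_ : #|{: 'I_(N F1) * 'I_(N F2)}| = _); last first.
  by rewrite card_prod !card_ord.
apply: (@join_number_le _ _ (fun k => P k.1 `&` Q k.2)).
  by move=> x; have [i Pi] := Pc x; have [j Qj] := Qc x; exists (i, j).
move=> [i j] g; rewrite inE /= => /orP[] gF.
  have /join_coverE[a aU ->] := P1 i.
  by case: (aU _ gF) => <-; [left|right] => x [/(_ _ gF)].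
have /join_coverE[a aU ->] := Q1 j.
by case: (aU _ gF) => <-; [left|right] => x [_ /(_ _ gF)].
Qed.

(** An itinerary over F c is the itinerary over F of the translate by T c. *)
Lemma join_number_mulfs F c : (N (mulfs F [fset c]) <= N F)%N.
Proof.
have [P [P1 Pc]] := has_subcoverP (join_has_subcover F).
rewrite -[leqRHS]card_ord.
apply: (@join_number_le _ _ (fun k => T c @^-1` P k)) => [x|i g].
  exact: Pc.
rewrite mulfs1E => /imfsetP[k /= kF ->]; have /join_coverE[a aU ->] := P1 i.
case: (aU _ kF) => <-; [left|right] => x /= /(_ _ kF);
by rewrite gtds_actM.
Qed.

Variable F : nat -> {fset G}.
Hypothesis folnerF : folner R F.

(** [limn] returns an arbitrary value on divergent sequences, so the sign of the
    entropy says nothing about cover numbers before this. *)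
Lemma htop_cvg : (fun n => ln ((N (F n))%:R : R) / (#|` F n|)%:R) @ \oo -->
  htop T F [set A; B].
Proof.
apply: (@ornstein_weiss R G F folnerF (fun K => ln (N K)%:R)).
- by rewrite join_number0 ln1.
- by move=> K; rewrite ln_ge0// ler1n join_number_gt0.
- move=> K1 K2; rewrite -lnM ?posrE ?ltr0n ?join_number_gt0//.
  rewrite ler_ln ?posrE -?natrM ?ltr0n ?ler_nat ?muln_gt0 ?join_number_gt0//.
  exact: join_numberU.
- move=> K c; rewrite ler_ln ?posrE ?ltr0n ?join_number_gt0//.
  by rewrite ler_nat join_number_mulfs.
Qed.

End JoinCover.

(** * Consequences of positive entropy *)

Section PositiveEntropy.
Variables (R : realType) (G : groupType) (X : pmetricType R) (T : G -> X -> X).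
Hypothesis T_gtds : gtds T.
Variable F : nat -> {fset G}.
Hypothesis folnerF : folner R F.
Variables Ux Uy : set X.
Hypothesis Uxy : Ux `&` Uy = set0.
Hypothesis htop_gt0 : 0 < htop T F [set ~` Ux; ~` Uy].

Lemma setCU_setT : ~` Ux `|` ~` Uy = setT.
Proof. by rewrite -setCI Uxy setC0. Qed.

Let N K := cover_number (join_cover T K [set ~` Ux; ~` Uy]).

Lemma entropy_growth : exists2 h : R, 0 < h &
  \forall n \near \oo, h * #|` F n|%:R < ln (N (F n))%:R.
Proof.
have := htop_cvg T_gtds setCU_setT folnerF.
have := htop_gt0; set l := htop _ _ _ => l0 cvl.
exists (l / 2); first by rewrite divr_gt0.
have : \forall n \near \oo, l / 2 < ln (N (F n))%:R / #|` F n|%:R.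
  by apply: cvgr_gt cvl _ _; lra.
apply: filterS => n; rewrite ltr_pdivlMr//.
exact: folner_card_gt0.
Qed.

Lemma ln_join_number_le (I : finType) K : (N K <= #|I|)%N ->
  ln (N K)%:R <= ln (#|I|%:R : R).
Proof.
have N0 : (0 < N K)%N by exact: (join_number_gt0 T_gtds setCU_setT).
move=> NI; rewrite ler_ln ?posrE ?ltr0n ?ler_nat//.
exact: leq_trans NI.
Qed.

(** Total boundedness, in the form used for coding orbit segments. *)
Lemma finite_net (r : R) : 0 < r ->
  exists D : {fset X}, forall x, exists2 y, y \in D & mdist y x < r.
Proof.
move=> r0.
have cov : [set: X] `<=` cover [set: X] (fun y => (ball y r)°).
  move=> x _; exists x => //.
  exact: nbhs_singleton (nbhs_interior (nbhsx_ballx x r r0)).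
have := gtds_compact T_gtds; rewrite compact_cover.
move=> /(_ _ _ _ (fun y _ => @open_interior X (ball y r)) cov)[D _ DX].
exists D => x; have [y yD /interior_subset] := DX x Logic.I.
by rewrite ballEmdist => yx; exists y.
Qed.

(** If all orbits had fewer than a #|F n| visits to Ux, the sets of visiting
    times would index a cover by itinerary sets: choose ~` Uy at the visiting
    times and ~` Ux at the others. Giving each visit the weight t, the total
    weight of all subsets of F n is (1 + t) ^ #|F n| and a set of at most
    a #|F n| times weighs at least t ^ (a #|F n|); for t and a small this
    leaves at most exp (h #|F n|) of them, fewer than the entropy requires. *)
Lemma entropy_visits : exists2 a : R, 0 < a &
  \forall n \near \oo, exists z,
    a * #|` F n|%:R <= #|` [fset g in F n | `[< Ux (T g z) >]]%fset|%:R.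
Proof.
have [h h0 hN] := entropy_growth.
exists (h ^+ 2 / 4); first by rewrite divr_gt0// exprn_gt0.
apply: filterS hN => n hN; apply: contrapT => /forallNP few.
have few' z : #|` [fset g in F n | `[< Ux (T g z) >]]%fset|%:R <=
  h ^+ 2 / 4 * #|` F n|%:R by rewrite leNgt; apply/negP => /ltW; exact: few.
pose I : finType := {E : {ffun F n -> bool} |
  #|[pred g | E g]|%:R <= h ^+ 2 / 4 * #|` F n|%:R}.
(* with this t, both t and a ln (1 / t) are at most h / 2 *)
pose t := expR (- (2 / h)).
have t_le : t <= h / 2.
  rewrite /t expRN -[h / 2]invrK lef_pV2 ?posrE ?invr_gt0 ?expR_gt0 ?divr_gt0//.
  rewrite invf_div (le_trans _ (expR_ge1Dx _))// lerDr//.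
have NI : (N (F n) <= #|{: I}|)%N.
  pose P (E : I) := [set z | forall g : F n, val E g = `[< Ux (T (val g) z) >]].
  apply: (join_number_le T_gtds (P := P)).
    move=> z; pose E := [ffun g : F n => `[< Ux (T (val g) z) >]].
    have cE : #|[pred g | E g]|%:R <= h ^+ 2 / 4 * #|` F n|%:R.
      apply: le_trans (few' z); rewrite ler_nat.
      rewrite card_fset_sum1 big_fset /= big_seq_fsetE /= sum1_card.
      by apply/eq_leq/eq_card => g; rewrite !inE ffunE.
    by exists (exist _ E cE) => g /=; rewrite ffunE.
  move=> E g gF; have [gE|gE] := boolP (val E (FSetSub gF)).
    right => z /(_ (FSetSub gF)); rewrite gE => /esym/asboolP /= Uxz Uyz.
    by have : (Ux `&` Uy) (T g z) by []; rewrite Uxy.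
  by left => z /(_ (FSetSub gF)); rewrite (negbTE gE) => /esym/asboolP.
have lnNI := ln_join_number_le NI.
have I0 : (0 < #|{: I}|)%N.
  apply: leq_trans NI; exact: (join_number_gt0 T_gtds setCU_setT).
suff leI : #|{: I}|%:R <= expR (h * #|` F n|%:R).
  have : ln #|{: I}|%:R <= h * #|` F n|%:R.
    by rewrite -[leRHS]expRK ler_ln ?posrE ?expR_gt0 ?ltr0n.
  lra.
have w (E : {ffun F n -> bool}) :
    #|[pred g | E g]|%:R <= h ^+ 2 / 4 * #|` F n|%:R ->
    expR (- (h / 2 * #|` F n|%:R)) <= t ^+ #|[pred g | E g]|.
  move=> cE; rewrite -expRM_natl ler_expR mulrN lerN2.
  rewrite -ler_pdivlMr ?divr_gt0// (le_trans cE)//.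
  rewrite invf_div [leRHS]mulrAC ler_wpM2r// expr2; lra.
have sumt : \sum_(E : {ffun F n -> bool}) t ^+ #|[pred g | E g]| <=
    expR (h / 2 * #|` F n|%:R).
  have -> : \sum_(E : {ffun F n -> bool}) t ^+ #|[pred g | E g]| =
      (t + 1) ^+ #|` F n|.
    have : \prod_(g : F n) \sum_b (if b then t else 1) =
        \sum_(E : {ffun F n -> bool}) \prod_g (if E g then t else 1).
      exact: bigA_distr_bigA.
    under eq_bigr do rewrite big_bool.
    rewrite prodr_const cardfE => ->; apply: eq_bigr => E _.
    by rewrite -big_mkcond /= prodr_const.
  apply: le_trans (_ : expR t ^+ #|` F n| <= _).
    by rewrite lerXn2r ?nnegrE ?addr_ge0 ?expR_ge0// addrC expR_ge1Dx.
  by rewrite -expRM_natl ler_expR mulrC ler_wpM2r.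
have : #|{: I}|%:R * expR (- (h / 2 * #|` F n|%:R)) <= expR (h / 2 * #|` F n|%:R).
  apply: le_trans sumt; rewrite card_sig -sum1_card natr_sum mulr_suml.
  rewrite [leRHS](bigID (fun E : {ffun F n -> bool} =>
    #|[pred g | E g]|%:R <= h ^+ 2 / 4 * #|` F n|%:R)) /=.
  rewrite -[leLHS]addr0 lerD//; last first.
    by apply: sumr_ge0 => E _; rewrite exprn_ge0// expR_ge0.
  by apply: ler_sum => E cE; rewrite mul1r; exact: w.
rewrite expRN ler_pdivrMr ?expR_gt0// -expRD -mulrDl.
by rewrite -splitr.
Qed.

Hypothesis T_potp : potp T.

(** The orbits of p and q can be exchanged inside F n as soon as they are close
    on the set Q of the times where a generator enters or leaves F n. There are
    at most #|D| ^ #|Q| classes of points that are indistinguishable on Q, and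
    #|Q| is small compared to #|F n|; since the cover number is larger, some
    class is not contained in an itinerary set, which provides p, q and a time
    g that sees p in Ux and q in Uy. Translating by g moves this event to the
    time 1. *)
Lemma entropy_asymptotic (e : R) : 0 < e ->
  exists p q, [/\ eps_asymptotic_pairs T e (p, q), Ux p &
    exists2 q0, Uy q0 & mdist q q0 <= e].
Proof.
move=> e0; have [d d0 [S tr]] := T_potp e0.
have [D DX] := finite_net (divr_gt0 d0 (ltr0n _ 2)).
have [h h0 hN] := entropy_growth.
(* adding 1 keeps L positive when the net is a single point *)
pose L : R := ln #|` D|%:R + 1.
have D0 : (0 < #|` D|)%N.
  by rewrite cardfs_gt0; have [y yD _] := DX point; apply/fset0Pn; exists y.
have L0 : 0 < L by rewrite ltr_wpDl// ln_ge0// ler1n.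
pose eta := h / L / 2.
have eta0 : 0 < eta by rewrite !divr_gt0.
have [n [hNn [inv1 inv2]]] : exists n, h * #|` F n|%:R < ln (N (F n))%:R /\
   (#|` (mulfs S (F n) `\` F n)%fset|%:R <= eta * #|` F n|%:R /\
    #|` inner_boundary (invfs S) (F n)|%:R <= eta * #|` F n|%:R).
  have [n _ /(_ n (leqnn n)) /= ?] := filterI hN (filterI
    (folner_mulfsD folnerF S eta0) (folner_inner_boundary folnerF (invfs S) eta0)).
  by exists n.
pose Q := ((mulfs S (F n) `\` F n) `|` inner_boundary (invfs S) (F n))%fset.
have cQ : #|` Q|%:R * L <= h * #|` F n|%:R.
  have : #|` Q|%:R <= 2 * eta * #|` F n|%:R.
    apply: (@le_trans _ _ (#|` (mulfs S (F n) `\` F n)%fset|%:R +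
        #|` inner_boundary (invfs S) (F n)|%:R)).
      by rewrite -natrD ler_nat (leq_card_fsetU _ _).1.
    lra.
  rewrite -(ler_pM2r L0); move=> /le_trans; apply.
  have -> : 2 * eta * #|` F n|%:R * L = (eta * 2 * L) * #|` F n|%:R by ring.
  by rewrite /eta !divfK// gt_eqF.
pose P (i : {ffun Q -> D}) :=
  [set p | forall g : Q, mdist (val (i g)) (T (val g) p) < d / 2].
have [i [p [q [g [gF [pi qi] [Uxp Uyq]]]]]] : exists i p q g,
   [/\ g \in F n, P i p /\ P i q & Ux (T g p) /\ Uy (T g q)].
  apply: contrapT => no.
  have NI : (N (F n) <= #|{ffun Q -> D}|)%N.
    apply: (join_number_le T_gtds (P := P)) => [z|i g gF].
      have /choice[c cP] : forall g : Q, exists y : D,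
          mdist (val y) (T (val g) z) < d / 2.
        by move=> g; have [y yD yz] := DX (T (val g) z); exists (Sub y yD).
      by exists [ffun g => c g] => g; rewrite ffunE.
    apply: contrapT => /not_orP[/existsNP[p /not_implyP[pi /contrapT Up]]].
    move=> /existsNP[q /not_implyP[qi /contrapT Uq]].
    by apply: no; exists i, p, q, g.
  have := ln_join_number_le NI; rewrite card_ffun natrX lnXn ?ltr0n -?cardfE//.
  rewrite -[leRHS]mulr_natl => le.
  have : ln (N (F n))%:R <= #|` Q|%:R * L.
    by rewrite (le_trans le)// ler_wpM2l// /L lerDl.
  lra.
have close k : k \in Q -> mdist (T k p) (T k q) < d.
  move=> kQ; have := pi (FSetSub kQ); have := qi (FSetSub kQ).
  move: (val (i _)) => y /= yq; rewrite metric_sym => py.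
  by rewrite (le_lt_trans (metric_triangle _ y _))//; lra.
pose w k := if k \in F n then T k q else T k p.
have [z zw] : exists z, traced T e w z.
  apply: tr => s k sS; rewrite /w.
  case: ifPn => kF; rewrite -(gtds_actM T_gtds); case: ifPn => skF;
    rewrite ?mdistxx//.
    rewrite metric_sym; by apply: close; rewrite in_fsetU in_fsetD skF mem_mulfs.
  apply: close; rewrite in_fsetU; apply/orP; right; apply/inner_boundaryP; split => //.
  by exists s^-1%g; [exact: mem_invfs | rewrite mulKg].
exists (T g p), (T g z); split => //.
  exists (mulfs (F n) [fset g^-1%g]) => k kg.
  have kF : (k * g)%g \notin F n.
    apply: contra kg => kF; rewrite -[k](mulgK g); apply: mem_mulfs => //.
    by rewrite inE.
  by have := zw (k * g)%g; rewrite /w (negbTE kF) metric_sym /= -!(gtds_actM T_gtds).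
by exists (T g q) => //; have := zw g; rewrite /w gF.
Qed.

End PositiveEntropy.

(** * Positive entropy from recurrent asymptotic pairs *)

(** A maximal subset D of W with pairwise disjoint translates K c is large: by
    maximality every point of W is in K^-1 K D. *)
Lemma separated_fsubset (G : groupType) (K W : {fset G}) : K != fset0 ->
  exists D, [/\ (D `<=` W)%fset,
    forall c c' k k', c \in D -> c' \in D -> k \in K -> k' \in K ->
      (k * c = k' * c')%g -> c = c' &
    (#|` W| <= #|` K| * #|` K| * #|` D|)%N].
Proof.
move=> K0.
pose sep (D : {fset G}) := forall c c' k k', c \in D -> c' \in D ->
  k \in K -> k' \in K -> (k * c = k' * c')%g -> c = c'.
pose P n := `[< exists D, [/\ (D `<=` W)%fset, sep D & #|` D| = n] >].
have exP : exists n, P n.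
  by exists 0%N; apply/asboolP; exists fset0; split => //; exact: fsub0set.
have bP n : P n -> (n <= #|` W|)%N.
  by move=> /asboolP[D [DW _ <-]]; exact: fsubset_leq_card.
case: (ex_maxnP exP bP) => n /asboolP[D [DW sD Dn]] nmax.
exists D; split => //.
suff /fsubset_leq_card h : (W `<=` mulfs (mulfs (invfs K) K) D)%fset.
  apply: leq_trans h _; apply: leq_trans (card_mulfs_le _ _) _.
  rewrite leq_mul2r; apply/orP; right; apply: leq_trans (card_mulfs_le _ _) _.
  by rewrite leq_mul2r card_invfs orbT.
apply/fsubsetP => w wW; apply: contrapT => wD.
have wf c k k' : c \in D -> k \in K -> k' \in K -> (k * w <> k' * c)%g.
  move=> cD kK k'K kw; apply: wD.
  by rewrite -[w](mulKg k) kw mulgA mem_mulfs// mem_mulfs// mem_invfs.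
have wnD : w \notin D.
  by case/fset0Pn : K0 => k kK; apply/negP => wD'; exact: (wf w k k).
have : P n.+1.
  apply/asboolP; exists (w |` D)%fset; split; last by rewrite cardfsU1 wnD Dn.
    by rewrite fsubUset fsub1set wW.
  move=> c c' k k'; rewrite !inE => /orP[/eqP ->|cD] /orP[/eqP ->|c'D] kK k'K e //.
  - by case: (wf _ _ _ c'D kK k'K).
  - by case: (wf _ _ _ cD k'K kK).
  - exact: (sD _ _ _ _ cD c'D kK k'K e).
by move=> /nmax; rewrite ltnn.
Qed.

Section Independence.
Variables (R : realType) (G : groupType) (X : pmetricType R) (T : G -> X -> X).
Hypothesis T_gtds : gtds T.

Lemma open_measurable_borel (V : set X) : open V ->
  measurable (V : set (borel X)).
Proof. by move=> oV; exact: sub_sigma_algebra. Qed.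

(** By invariance the mean over mu of the number of visits to V during K is
    mu V #|K|, so some point has at least half as many. *)
Lemma measure_visits (mu : probability (borel X) R) (V : set X) (K : {fset G}) :
  invariant_measure T mu -> open V -> (0 < mu V)%E ->
  exists z, fine (mu V) / 2 * #|` K|%:R <=
    #|` [fset g in K | `[< V (T g z) >]]%fset|%:R.
Proof.
move=> Tmu oV muV; apply: contrapT => /forallNP few.
have few' z : #|` [fset g in K | `[< V (T g z) >]]%fset|%:R <=
  fine (mu V) / 2 * #|` K|%:R by rewrite leNgt; apply/negP => /ltW; exact: few.
have K0 : 0 < #|` K|%:R :> R.
  rewrite lt_neqAle ler0n andbT eq_sym; apply/eqP => K0; apply: (few point).
  by rewrite K0 mulr0.
have oT g : open (T g @^-1` V).
  by move/continuousP : (@gtds_continuous _ _ _ _ T_gtds g); exact.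
have mT g : measurable (T g @^-1` V : set (borel X)) by exact: open_measurable_borel.
have muVE : mu V = (fine (mu V))%:E 
  by rewrite fineK// fin_num_measure//; exact: open_measurable_borel.
have visitsE z : (#|` [fset g in K | `[< V (T g z) >]]%fset|%:R)%:E =
    \sum_(g <- K) (\1_(T g @^-1` V) z)%:E :> \bar R.
  rewrite sumEFin card_fset_sum1 natr_sum big_fset /= big_mkcond /=.
  congr EFin; apply: eq_bigr => g _; rewrite indicE.
  have -> : (z \in T g @^-1` V) = `[< V (T g z) >].
    by apply/idP/asboolP => [/set_mem|/mem_set].
  by case: asboolP.
have : (\int[mu]_z (\sum_(g <- K) (\1_(T g @^-1` V) z)%:E) <=
    \int[mu]_(z in [set: borel X]) (fine (mu V) / 2 * #|` K|%:R)%:E)%E.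
  apply: ge0_le_integral => //.
  - by move=> z _; rewrite -visitsE lee_fin.
  - apply: emeasurable_sum => g; apply/measurable_EFinP.
    exact: measurable_indic.
  - by move=> z _; rewrite -visitsE lee_fin few'.
rewrite integral_cst// [X in (_ <= _ * X)%E](@probability_setT _ _ _ mu) mule1.
rewrite ge0_integral_sum//; last first.
  by move=> g; apply/measurable_EFinP; exact: measurable_indic.
have intV g : (\int[mu]_z (\1_(T g @^-1` V) z)%:E = mu V)%E.
  by rewrite integral_indic ?setIT //; exact: (Tmu g _ (open_measurable_borel oV)).
under eq_bigr do rewrite intV.
rewrite muVE sumEFin lee_fin.
have -> : \sum_(g <- K) fine (mu V) = fine (mu V) * #|` K|%:R.
  by rewrite (card_fset_sum1 K) natr_sum mulr_sumr; under [RHS]eq_bigr do rewrite mulr1.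
have : 0 < fine (mu V) by rewrite -lte_fin -muVE.
move=> h; have := mulr_gt0 h K0; lra.
Qed.

Variable F : nat -> {fset G}.
Hypotheses (folnerF : folner R F) (T_potp : potp T).

(** Outside F0 the orbits of x and y are close. Enlarging F0 to F1 ensures that
    whenever a generator s enters or leaves F1, it arrives at a time outside
    F0; there the orbits of y, of x and of any z in V' agree up to d, so that
    replacing the orbit of z by that of y on F1 c yields a pseudo-orbit. The
    set K contains F1 and its exits, and the times c are chosen so that the
    translates K c are disjoint, which makes the replacements independent. *)
Theorem asymptotic_entropy (mu : probability (borel X) R) x y (Ux Uy : set X) :
  invariant_measure T mu -> measure_support mu x -> asymptotic_pairs T (x, y) ->
  nbhs x Ux -> nbhs y Uy -> Ux `&` Uy = set0 ->
  0 < htop T F [set ~` Ux; ~` Uy].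
Proof.
move=> Tmu supx asym /nbhs_ballP[rx /= rx0 xU] /nbhs_ballP[ry /= ry0 yU] Uxy.
pose r := Num.min rx ry.
have r0 : 0 < r by rewrite lt_min rx0.
have e0 : 0 < r / 2 by rewrite divr_gt0.
have Uxr p : mdist x p < r -> Ux p.
  by move=> h; apply: xU; rewrite ballEmdist /= (lt_le_trans h)// ge_min lexx.
have Uyr p : mdist y p < r -> Uy p.
  by move=> h; apply: yU; rewrite ballEmdist /= (lt_le_trans h)// ge_min lexx orbT.
have [d d0 [S tr]] := T_potp e0.
have d40 : 0 < d / 4 by rewrite divr_gt0.
have [F0 F0P] := asym _ d40.
(* 1 belongs to F1 so that the replacement is visible at the time c itself *)
pose F1 : {fset G} := (1%g |` (F0 `|` mulfs (invfs S) F0))%fset.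
pose K : {fset G} := (F1 `|` mulfs S F1)%fset.
have F1K : {subset F1 <= K} by move=> k kF; rewrite inE kF.
have SF1K s k : s \in S -> k \in F1 -> (s * k)%g \in K.
  by move=> sS kF; rewrite in_fsetU mem_mulfs ?orbT.
have F11 : 1%g \in F1 by rewrite !inE eqxx.
have F0F1 k : k \notin F1 -> k \notin F0.
  by apply: contra => kF; rewrite !inE kF orbT.
have SF0F1 s k : s \in S -> (s^-1 * k)%g \notin F1 -> k \notin F0.
  move=> sS; apply: contra => kF; rewrite /F1 in_fsetU in_fsetU.
  by rewrite [X in [|| _, _ | X]]mem_mulfs ?orbT// mem_invfs.
have K0 : K != fset0 by apply/fset0Pn; exists 1%g; exact: F1K.
pose V' := (\bigcap_(k in [set` K]) [set z | mdist (T k x) (T k z) < d / 2])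
   `&` [set z | mdist x z < r / 2].
have nV' : nbhs x V'.
  apply: filterI; last first.
    by apply/nbhs_ballP; exists (r / 2) => //=; rewrite ballEmdist.
  apply: filter_bigI => k kK.
  have := @gtds_continuous _ _ _ _ T_gtds k x => /(_ (ball (T k x) (d / 2))).
  rewrite ballEmdist => /(_ _); apply.
  by rewrite -ballEmdist; apply: nbhsx_ballx; rewrite divr_gt0.
pose V := V'°.
have oV : open V by exact: open_interior.
have Vx : V x by exact: nV'.
have muV := supx _ oV Vx.
have muVf : 0 < fine (mu V).
  by rewrite fine_gt0// muV/= ltey_eq fin_num_measure//; exact: open_measurable_borel.
pose beta := fine (mu V) / 2 / (#|` K| * #|` K|)%:R * ln 2.
have Kn0 : 0 < (#|` K| * #|` K|)%:R :> R by rewrite ltr0n muln_gt0 !cardfs_gt0 K0.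
have beta0 : 0 < beta by rewrite !mulr_gt0 ?invr_gt0// ln_gt0// ltr1n.
apply: (lt_le_trans beta0).
have AB := setCU_setT Uxy.
have cv := htop_cvg T_gtds AB folnerF.
rewrite -(cvg_lim _ cv)//.
apply: limr_ge; first by apply/cvg_ex; eexists; exact: cv.
apply: nearW => n.
have [z zV] := measure_visits (F n) Tmu oV muV.
set W := [fset g in F n | `[< V (T g z) >]]%fset in zV.
have [D [DW sep cD]] := separated_fsubset W K0.
have DV c : c \in D -> c \in F n /\ V' (T c z).
  move/fsubsetP : DW => /[apply]; rewrite !inE => /andP[cF /asboolP]; split => //.
  exact: interior_subset.
rewrite ler_pdivlMr ?folner_card_gt0//.
apply: (@le_trans _ _ (#|` D|%:R * ln 2)).
  rewrite /beta mulrAC ler_wpM2r ?ln_ge0 ?ler1n//.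
  rewrite mulrAC ler_pdivrMr// (le_trans zV)// -natrM ler_nat mulnC.
  exact: cD.
rewrite mulr_natl -lnXn ?ltr0n// -natrX.
have sub := join_has_subcover T_gtds AB (F n).
have N0 := join_number_gt0 T_gtds AB (F n).
rewrite ler_ln ?posrE ?ltr0n ?expn_gt0// ler_nat.
have -> : (2 ^ #|` D| = #|{ffun D -> bool}|)%N.
  by rewrite card_ffun card_bool cardfE.
pose swap (E : {ffun D -> bool}) g (c : D) := E c && ((g * (val c)^-1)%g \in F1).
pose w (E : {ffun D -> bool}) g :=
  if [pick c | swap E g c] is Some c then T (g * (val c)^-1)%g y else T g z.
have swap_inj E g c c' : swap E g c -> swap E g c' -> c = c'.
  move=> /andP[_ cF] /andP[_ c'F]; apply/val_inj.
  apply: (sep _ _ _ _ (valP c) (valP c') (F1K _ cF) (F1K _ c'F)).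
  by rewrite !mulgVK.
have wS E g c : swap E g c -> w E g = T (g * (val c)^-1)%g y.
  rewrite /w; case: pickP => [c' h' h|no]; last by rewrite no.
  by rewrite (swap_inj _ _ _ _ h h').
(* the two orbits that are exchanged agree wherever a generator crosses F1 c *)
have close k c : c \in D -> k \in K -> k \notin F0 ->
    mdist (T k y) (T (k * c)%g z) < d.
  move=> cD' kK kF0; have [_ [/(_ k kK) /= h _]] := DV _ cD'.
  have := F0P _ kF0 => /= xy.
  rewrite (gtds_actM T_gtds) (le_lt_trans (metric_triangle _ (T k x) _))//.
  rewrite metric_sym; lra.
have tru E : exists u, traced T (r / 2) (w E) u.
  apply: tr => s g sS.
  have [[c gc]|ng] := pselect (exists c, swap E g c).
    rewrite (wS _ _ _ gc) -(gtds_actM T_gtds) mulgA.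
    have [Ec gF] := andP gc.
    have [[c' sgc]|nsg] := pselect (exists c, swap E (s * g)%g c).
      rewrite (wS _ _ _ sgc).
      suff -> : c = c' by rewrite mdistxx.
      have [_ sgF] := andP sgc; apply/val_inj.
      apply: (sep _ _ _ _ (valP c) (valP c') (SF1K _ _ sS gF) (F1K _ sgF)).
      by rewrite mulgVK mulgA mulgVK.
    rewrite {1}/w; case: pickP => [c' h'|no]; first by case: nsg; exists c'.
    rewrite -[X in T X z](mulgVK (val c)); apply: close => //.
    + exact: valP.
    + by rewrite -mulgA; exact: SF1K.
    + apply: F0F1; apply/negP => sgF; apply: nsg; exists c.
      by rewrite /swap Ec.
  have -> : w E g = T g z.
    by rewrite /w; case: pickP => [c h|//]; case: ng; exists c.
  rewrite -(gtds_actM T_gtds).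
  have [[c sgc]|nsg] := pselect (exists c, swap E (s * g)%g c); last first.
    rewrite /w; case: pickP => [c h|_]; first by case: nsg; exists c.
    by rewrite mdistxx.
  rewrite (wS _ _ _ sgc) metric_sym -[X in T X z](mulgVK (val c)).
  have [Ec sgF] := andP sgc.
  apply: close; [exact: valP | exact: F1K |].
  apply: (SF0F1 _ _ sS); rewrite !mulgA mulVg mul1g; apply/negP => gF.
  by apply: ng; exists c; rewrite /swap Ec.
have [u uP] := choice tru.
have uUy (E : {ffun D -> bool}) (c : D) : E c -> Uy (T (val c) (u E)).
  move=> Ec; apply: Uyr; have := uP E (val c).
  rewrite (wS _ _ c) ?mulgV ?(gtds_act1 T_gtds); last by rewrite /swap Ec mulgV.
  rewrite metric_sym; lra.
have uUx (E : {ffun D -> bool}) (c : D) : E c = false -> Ux (T (val c) (u E)).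
  move=> Ec; apply: Uxr; have := uP E (val c).
  have [_ [_ /= xz]] := DV _ (valP c).
  rewrite /w; case: pickP => [c' /andP[Ec' h]|_].
    move: Ec; suff -> : c = c' by rewrite Ec'.
    apply/val_inj/(sep _ _ _ _ (valP c) (valP c') (F1K _ F11) (F1K _ h)).
    by rewrite mulgVK mul1g.
  rewrite metric_sym => h.
  rewrite (le_lt_trans (metric_triangle _ (T (val c) z) _))//; lra.
apply: (cover_number_ge (w := u)) => // A E E' /join_coverE.
move=> /(_ T_gtds)[a aU ->] h h'.
apply/ffunP => c; have cF := (DV _ (valP c)).1.
have := h _ cF; have := h' _ cF.
case: (aU _ cF) => -> /= ha' ha.
  case E1 : (E c); last by have := uUx _ _ E1.
  by case E2 : (E' c) => //; have := uUx _ _ E2.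
case E1 : (E c); first by have := uUy _ _ E1.
by case E2 : (E' c) => //; have := uUy _ _ E2.
Qed.

End Independence.

(** * Borel measures from finitely additive means *)

Section MeasureFromMean.
Variables (R : realType) (X : pmetricType R).
Hypothesis cX : compact [set: X].
Variable m : set X -> R.
Hypotheses (m_ge0 : forall A, 0 <= m A) (mT : m setT = 1)
  (mU : forall A B, A `&` B = set0 -> m (A `|` B) = m A + m B).

Lemma mean0 : m set0 = 0.
Proof. by have := mU (setI0 (@set0 X)); rewrite setU0; lra. Qed.

Lemma le_mean A B : A `<=` B -> m A <= m B.
Proof.
move=> AB; rewrite -(setUIDK B A) setIC (setIidl AB) mU ?lerDl//.
by rewrite -subset0 => x [Ax []].
Qed.

Lemma mean_le1 A : m A <= 1.
Proof. by rewrite -mT; exact: le_mean. Qed.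

Lemma le_meanU A B : m (A `|` B) <= m A + m B.
Proof.
have -> : A `|` B = A `|` (B `\` A).
  rewrite eqEsubset; split=> x [Ax|Bx]; do ?by left.
    by have [Ax|nA] := pselect (A x); [left|right].
  by right; case: Bx.
rewrite mU ?lerD2l ?le_mean //.
by rewrite -subset0 => x [Ax []].
Qed.

(** The mean of an open set may exceed what its closed subsets account for;
    countable subadditivity holds for this inner approximation only, thanks to
    compactness. *)
Definition open_mass (O : set X) : R :=
  sup [set m K | K in [set K | closed K /\ K `<=` O]].

Let mass_has_sup O : has_sup [set m K | K in [set K | closed K /\ K `<=` O]].
Proof.
split; first by exists (m set0), set0 => //; split; [exact: closed0|].
by exists 1 => _ [K _ <-]; exact: mean_le1.
Qed.

Lemma open_mass_ge K O : closed K -> K `<=` O -> m K <= open_mass O.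
Proof.
by move=> cK KO; apply: ub_le_sup; [exact: (mass_has_sup O).2 | exists K].
Qed.

Lemma open_mass_le O M :
  (forall K, closed K -> K `<=` O -> m K <= M) -> open_mass O <= M.
Proof.
move=> h; apply: ge_sup; first exact: (mass_has_sup O).1.
by move=> _ [K [cK KO] <-]; exact: h.
Qed.

Lemma open_mass_adherent O e : 0 < e ->
  exists K, [/\ closed K, K `<=` O & open_mass O - e < m K].
Proof.
move=> e0; have [_ [K [cK KO] <-] h] := sup_adherent e0 (mass_has_sup O).
by exists K.
Qed.

Lemma open_mass_ge0 O : 0 <= open_mass O.
Proof.
by rewrite -mean0; apply: open_mass_ge => //; exact: closed0.
Qed.

Lemma open_mass0 : open_mass set0 = 0.
Proof.
apply/eqP; rewrite eq_le open_mass_ge0 andbT; apply: open_mass_le => K _.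
by rewrite subset0 => ->; rewrite mean0.
Qed.

(** By normality, a closed subset of A `|` B is the union of a closed subset of
    A and a closed subset of B. *)
Lemma open_massU A B : open A -> open B ->
  open_mass (A `|` B) <= open_mass A + open_mass B.
Proof.
move=> oA oB; apply: open_mass_le => K cK KAB.
have cKA : closed (K `\` A) by rewrite setDE; apply: closedI => //; exact: open_closedC.
have cKB : closed (K `\` B) by rewrite setDE; apply: closedI => //; exact: open_closedC.
have KAKB : (K `\` A) `&` (K `\` B) = set0.
  rewrite -subset0 => x [[Kx nA] [_ nB]].
  by case: (KAB _ Kx).
have := @pseudometric_normal R X; move/(@normal_openP R).
move=> /(_ _ _ cKA cKB KAKB)[V [W [oV oW KAV KBW VW]]].
apply: (@le_trans _ _ (m (K `\` V) + m (K `\` W))).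
  apply: le_trans (le_meanU _ _); apply: le_mean => x Kx.
  have [Vx|nV] := pselect (V x); last by left.
  right; split=> // Wx; have : (V `&` W) x by [].
  by rewrite VW.
apply: lerD; apply: open_mass_ge.
- by rewrite setDE; apply: closedI => //; exact: open_closedC.
- by move=> x [Kx nV]; apply: contrapT => nA; exact/nV/KAV.
- by rewrite setDE; apply: closedI => //; exact: open_closedC.
- by move=> x [Kx nV]; apply: contrapT => nA; exact/nV/KBW.
Qed.

Lemma open_mass_bigsetU (O : (set X)^nat) n : (forall i, open (O i)) ->
  open (\big[setU/set0]_(i < n) O i) /\
  open_mass (\big[setU/set0]_(i < n) O i) <= \sum_(i < n) open_mass (O i).
Proof.
move=> oO; elim: n => [|n [oU IH]].
  by rewrite !big_ord0 open_mass0; split => //; exact: open0.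
rewrite !big_ord_recr /=; split; first exact: openU.
by rewrite (le_trans (open_massU _ _))// lerD2r.
Qed.

(** A closed set is compact, hence already covered by finitely many of the open
    sets. *)
Lemma open_mass_bigcup (O : (set X)^nat) : (forall i, open (O i)) ->
  ((open_mass (\bigcup_i O i))%:E <= \sum_(i <oo) (open_mass (O i))%:E)%E.
Proof.
move=> oO; apply/lee_addgt0Pr => e e0.
have [K [cK KO Ke]] := open_mass_adherent (\bigcup_i O i) e0.
have coK : compact K by exact: subclosed_compact cK cX _.
move: coK; rewrite compact_cover => /(_ nat setT O (fun i _ => oO i) KO)[D _ KD].
pose n := (\max_(i <- D) i).+1.
have Kn : K `<=` \big[setU/set0]_(i < n) O i.
  rewrite -bigcup_mkord => x /KD[i /= iD Oix]; exists i => //=.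
  by rewrite ltnS; exact: (@leq_bigmax_seq _ _ xpredT id).
have [_ h] := open_mass_bigsetU n oO.
have le1 := open_mass_ge cK Kn.
apply: (@le_trans _ _ (\sum_(0 <= i < n) (open_mass (O i))%:E + e%:E)%E).
  rewrite sumEFin -EFinD lee_fin big_mkord; lra.
rewrite leeD2r//; apply: nneseries_lim_ge => i _.
by rewrite lee_fin open_mass_ge0.
Qed.

Definition outer_mass (A : set X) : R :=
  inf [set open_mass O | O in [set O | open O /\ A `<=` O]].

Let outer_has_inf A :
  has_inf [set open_mass O | O in [set O | open O /\ A `<=` O]].
Proof.
split; first by exists (open_mass setT), setT => //; split; [exact: openT|].
by exists 0 => _ [K _ <-]; exact: open_mass_ge0.
Qed.

Lemma outer_mass_le A O : open O -> A `<=` O -> outer_mass A <= open_mass O.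
Proof.
by move=> oO AO; apply: ge_inf; [exact: (outer_has_inf A).2 | exists O].
Qed.

Lemma outer_mass_ge A M :
  (forall O, open O -> A `<=` O -> M <= open_mass O) -> M <= outer_mass A.
Proof.
move=> h; apply: lb_le_inf; first exact: (outer_has_inf A).1.
by move=> _ [U [oU AU] <-]; exact: h.
Qed.

Lemma outer_mass_adherent A e : 0 < e ->
  exists O, [/\ open O, A `<=` O & open_mass O < outer_mass A + e].
Proof.
move=> e0; have [_ [U [oU AU] <-] h] := inf_adherent e0 (outer_has_inf A).
by exists U.
Qed.

Lemma outer_mass_ge0 A : 0 <= outer_mass A.
Proof. by apply: outer_mass_ge => O _ _; exact: open_mass_ge0. Qed.

Lemma le_outer_mass A B : A `<=` B -> outer_mass A <= outer_mass B.
Proof.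
move=> AB; apply: outer_mass_ge => O oO BO; apply: outer_mass_le => //.
exact: subset_trans BO.
Qed.

(** This inequality is why the regularization is done from outside. *)
Lemma mean_le_outer_mass K : closed K -> m K <= outer_mass K.
Proof. by move=> cK; apply: outer_mass_ge => O _ KO; exact: open_mass_ge. Qed.

Definition outer_massE (A : set X) : \bar R := (outer_mass A)%:E.

Let outer_massE0 : outer_massE set0 = 0%E.
Proof.
congr EFin; apply/eqP; rewrite eq_le outer_mass_ge0 andbT -open_mass0.
by apply: outer_mass_le => //; exact: open0.
Qed.

Let outer_massE_ge0 A : (0 <= outer_massE A)%E.
Proof. by rewrite lee_fin outer_mass_ge0. Qed.

Let le_outer_massE : {homo outer_massE : A B / A `<=` B >-> (A <= B)%E}.
Proof. by move=> A B AB; rewrite lee_fin le_outer_mass. Qed.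

Let outer_massE_sigma_subadditive : sigma_subadditive outer_massE.
Proof.
move=> A; apply/lee_addgt0Pr => e e0.
have e2 n : 0 < e / (2 ^ n.+1)%:R by rewrite divr_gt0// ltr0n expn_gt0.
have /choice[U UP] := fun n => outer_mass_adherent (A n) (e2 n).
apply: (@le_trans _ _ (\sum_(i <oo) (outer_massE (A i) + (e / (2 ^ i.+1)%:R)%:E))%E).
  apply: (@le_trans _ _ (open_mass (\bigcup_i U i))%:E).
    rewrite lee_fin; apply: outer_mass_le.
      by apply: bigcup_open => i _; have [] := UP i.
    apply: subset_bigcup => i _; by have [] := UP i.
  apply: le_trans (open_mass_bigcup _) _; first by move=> i; have [] := UP i.
  apply: lee_nneseries => i _; first by rewrite lee_fin open_mass_ge0.
  by rewrite -EFinD lee_fin ltW//; have [] := UP i.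
apply: epsilon_trick => //; exact: ltW.
Qed.

HB.instance Definition _ := isOuterMeasure.Build R X outer_massE
  outer_massE0 outer_massE_ge0 le_outer_massE outer_massE_sigma_subadditive.

(** Given an open V containing A, fill V `&` O almost completely by a closed K,
    then V `\` K, which contains A minus O, by a closed K'. As K and K' are
    disjoint, their means add up inside V. *)
Lemma open_caratheodory O : open O -> outer_massE.-caratheodory O.
Proof.
move=> oO; apply: le_caratheodory_measurable => A.
rewrite -EFinD lee_fin; apply: outer_mass_ge => V oV AV.
apply/ler_addgt0Pr => e e0; have e20 : 0 < e / 2 by rewrite divr_gt0.
have [K [cK KVO Ke]] := open_mass_adherent (V `&` O) e20.
have [K' [cK' KVK Ke']] := open_mass_adherent (V `\` K) e20.
have oVK : open (V `\` K) by rewrite setDE; apply: openI => //; exact: closed_openC.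
have h1 : outer_mass (A `&` O) <= open_mass (V `&` O).
  by apply: outer_mass_le; [exact: openI | exact: setSI].
have h2 : outer_mass (A `&` ~` O) <= open_mass (V `\` K).
  apply: outer_mass_le => // x [Ax nO]; split; first exact: AV.
  by move=> /KVO[].
have h3 : m K + m K' <= open_mass V.
  rewrite -mU; last by rewrite -subset0 => x [Kx /KVK[]].
  apply: open_mass_ge; first exact: closedU.
  by move=> x [/KVO[]|/KVK[]].
lra.
Qed.

Lemma borel_caratheodory (A : set (borel X)) : measurable A ->
  outer_massE.-caratheodory A.
Proof.
move=> mA.
have sub : <<s @open X >> `<=` outer_massE.-cara.-measurable.
  apply: smallest_sub; last by move=> O oO; exact: open_caratheodory.
  exact: sigma_algebra_measurable.
exact: sub.
Qed.

(** [outer_massE] carries the structure of an outer measure on all subsets; this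
    copy, on Borel sets, receives that of a probability. *)
Definition borel_mass : set (borel X) -> \bar R := outer_massE.

Let borel_mass0 : borel_mass set0 = 0%E. Proof. exact: outer_massE0. Qed.

Let borel_mass_ge0 A : (0 <= borel_mass A)%E.
Proof. exact: outer_massE_ge0. Qed.

Let borel_mass_sigma_additive : semi_sigma_additive borel_mass.
Proof.
move=> A mA tA mbA.
apply: (@caratheodory_measure_sigma_additive R X outer_massE) => //.
  by move=> i; exact: borel_caratheodory (mA i).
exact: borel_caratheodory mbA.
Qed.

HB.instance Definition _ := isMeasure.Build _ (borel X) R borel_mass
  borel_mass0 borel_mass_ge0 borel_mass_sigma_additive.

Let borel_massT : borel_mass setT = 1%E.
Proof.
congr EFin; apply/eqP; rewrite eq_le; apply/andP; split.
  apply: le_trans (outer_mass_le openT (@subsetT _ _)) _.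
  by apply: open_mass_le => K _ _; exact: mean_le1.
rewrite -mT; apply: mean_le_outer_mass; exact: closedT.
Qed.

HB.instance Definition _ :=
  Measure_isProbability.Build _ (borel X) R borel_mass borel_massT.

Lemma borel_mass_closed K : closed K -> ((m K)%:E <= borel_mass K)%E.
Proof. by move=> cK; rewrite lee_fin mean_le_outer_mass. Qed.

Lemma outer_mass_preimage_le (h h' : X -> X) A : cancel h h' -> cancel h' h ->
  continuous h -> continuous h' -> (forall B, m (h @^-1` B) = m B) ->
  outer_mass (h @^-1` A) <= outer_mass A.
Proof.
move=> hK h'K ch ch' hm; apply: outer_mass_ge => O oO AO.
apply: (@le_trans _ _ (open_mass (h @^-1` O))).
  apply: outer_mass_le; last by move=> x; exact: AO.
  by move/continuousP : ch; exact.
apply: open_mass_le => K cK KO.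
have -> : m K = m (h' @^-1` K).
  rewrite -(hm (h' @^-1` K)); congr m; apply/funext => x /=.
  by rewrite /preimage /= hK.
apply: open_mass_ge; first by move/continuous_closedP : ch'; exact.
by move=> x /= /KO; rewrite /preimage/= h'K.
Qed.

Lemma borel_mass_preimage (h h' : X -> X) A : cancel h h' -> cancel h' h ->
  continuous h -> continuous h' -> (forall B, m (h @^-1` B) = m B) ->
  borel_mass (h @^-1` A) = borel_mass A.
Proof.
move=> hK h'K ch ch' hm; congr EFin; apply/eqP; rewrite eq_le.
rewrite (outer_mass_preimage_le _ hK h'K)//=.
have h'm B : m (h' @^-1` B) = m B.
  rewrite -(hm (h' @^-1` B)); congr m; apply/funext => x /=.
  by rewrite /preimage /= hK.
have := outer_mass_preimage_le (h @^-1` A) h'K hK ch' ch h'm.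
congr (outer_mass _ <= _); apply/funext => x /=.
by rewrite /preimage /= h'K.
Qed.

(** Riesz representation for means, without functions: invariance is inherited
    because the construction only uses m and the topology. *)
Theorem measure_of_mean : exists mu : probability (borel X) R,
  (forall K : set X, closed K -> ((m K)%:E <= mu K)%E) /\
  (forall (h h' : X -> X) (A : set X), cancel h h' -> cancel h' h ->
    continuous h -> continuous h' -> (forall B, m (h @^-1` B) = m B) ->
    mu (h @^-1` A) = mu A).
Proof.
exists (borel_mass : probability (borel X) R); split.
  exact: borel_mass_closed.
exact: borel_mass_preimage.
Qed.

End MeasureFromMean.

(** * Invariant measures from frequent visits *)

Lemma ultra_cvg_bounded (R : realType) (I : Type) (U : set_system I) (f : I -> R) a b :
  UltraFilter U -> (forall i, a <= f i <= b) -> exists l : R, f @ U --> l.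
Proof.
move=> UU fab.
have PU : ProperFilter U by exact: ultra_proper.
have [l [_ cl]] : `[a, b] `&` cluster (f @ U) !=set0.
  apply: segment_compact; rewrite /fmap /=.
  by apply: filterE => i; rewrite /preimage /= in_itv /= fab.
exists l => B Bl; have [//|UnB] := in_ultra_setVsetC (f @^-1` B) UU.
by have [r []] := cl (~` B) B UnB Bl.
Qed.

Section InvariantMean.
Variables (R : realType) (G : groupType) (X : pmetricType R) (T : G -> X -> X).
Hypothesis T_gtds : gtds T.
Variable F : nat -> {fset G}.
Hypothesis folnerF : folner R F.
Variable z : nat -> X.

Definition visits (A : set X) n : {fset G} :=
  [fset g in F n | `[< A (T g (z n)) >]]%fset.

Lemma visitsP A n g : reflect (g \in F n /\ A (T g (z n))) (g \in visits A n).
Proof. by rewrite !inE; apply: (iffP andP) => -[gF /asboolP]. Qed.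

Definition visit_freq (A : set X) n : R := #|` visits A n|%:R / #|` F n|%:R.

Lemma visit_freq_itv A n : 0 <= visit_freq A n <= 1.
Proof.
rewrite divr_ge0//= ler_pdivrMr ?folner_card_gt0// mul1r ler_nat.
by apply: fsubset_leq_card; apply/fsubsetP => g /visitsP[].
Qed.

Lemma visit_freqT n : visit_freq setT n = 1.
Proof.
rewrite /visit_freq (_ : visits _ _ = F n) ?divff// ?gt_eqF ?folner_card_gt0//.
by apply/fsetP => g; apply/visitsP/idP => [[]|].
Qed.

Lemma visit_freqU A B n : A `&` B = set0 ->
  visit_freq (A `|` B) n = visit_freq A n + visit_freq B n.
Proof.
move=> AB; rewrite /visit_freq -mulrDl -natrD; congr (_%:R / _).
rewrite -cardfsUI (_ : (visits A n `&` visits B n)%fset = fset0).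
  rewrite cardfs0 addn0; congr (#|` _|); apply/fsetP => g.
  rewrite inE; apply/visitsP/orP.
    by move=> [gF [?|?]]; [left|right]; apply/visitsP.
  by move=> [] /visitsP[gF ?]; split => //; [left|right].
apply/fsetP => g; rewrite !in_fsetI in_fset0.
apply/andP => -[/visitsP[_ Ag] /visitsP[_ Bg]].
by have : (A `&` B) (T g (z n)) by []; rewrite AB.
Qed.

(** The times g at which k g is a visit correspond to the visits at times of
    k F n, a set that differs little from F n. *)
Lemma visit_freq_shift k A n : visit_freq (T k @^-1` A) n <=
  visit_freq A n + #|` (mulfs [fset k] (F n) `\` F n)%fset|%:R / #|` F n|%:R.
Proof.
rewrite /visit_freq -mulrDl ler_wpM2r ?invr_ge0// -natrD ler_nat.
have -> : #|` visits (T k @^-1` A) n| =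
    #|` [fset (k * g)%g | g in visits (T k @^-1` A) n]%fset|.
  by rewrite [RHS]card_imfset//; exact: mulgI.
apply: leq_trans (leq_card_fsetU _ _).1; apply: fsubset_leq_card.
apply/fsubsetP => x /imfsetP[g /= /visitsP[gF /=]].
rewrite /preimage /= -(gtds_actM T_gtds) => Akg ->.
have kgF : (k * g)%g \in mulfs [fset k] (F n) by rewrite mem_mulfs// inE.
rewrite in_fsetU in_fsetD kgF andbT.
have [kF|kF] := boolP ((k * g)%g \in F n); last by rewrite orbT.
by apply/orP; left; apply/visitsP.
Qed.

(** Krylov-Bogoliubov: the limit of the visit frequencies along an ultrafilter
    finer than the cofinite one is a mean defined on all subsets, invariant
    since F is a Folner sequence. *)
Theorem visits_invariant_measure a (K : set X) : 0 < a -> closed K ->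
  (\forall n \near \oo, a <= visit_freq K n) ->
  exists mu : probability (borel X) R, invariant_measure T mu /\ (0 < mu K)%E.
Proof.
move=> a0 cK Ka.
have [U [UU ooU]] := ultraFilterLemma (F := \oo) _.
have PU : ProperFilter U by exact: ultra_proper.
have /choice[m mP] := fun A : set X => ultra_cvg_bounded UU (visit_freq_itv A).
have m_ge0 A : 0 <= m A.
  apply: (ler_cvg_to (cvg_cst 0) (mP A)); apply: nearW => n.
  by have /andP[] := visit_freq_itv A n.
have mT : m setT = 1.
  apply: (cvg_unique _ (mP setT)) => //.
  rewrite (_ : visit_freq setT = cst 1); first exact: cvg_cst.
  by apply/funext => n; exact: visit_freqT.
have mU A B : A `&` B = set0 -> m (A `|` B) = m A + m B.
  move=> AB; apply: (cvg_unique _ (mP (A `|` B))) => //.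
  rewrite (_ : visit_freq (A `|` B) = visit_freq A \+ visit_freq B).
    exact: cvgD.
  by apply/funext => n; exact: visit_freqU.
have m_shift_le k A : m (T k @^-1` A) <= m A.
  apply/ler_addgt0Pr => e e0.
  apply: (ler_cvg_to (mP _) (cvgD (mP A) (cvg_cst e))).
  apply: ooU; apply: filterS (folner_mulfsD folnerF [fset k] e0) => n h.
  apply: le_trans (visit_freq_shift _ _ _) _.
  by rewrite lerD2l ler_pdivrMr// folner_card_gt0.
(* the reverse inequality is the same one for k^-1 *)
have m_shift k A : m (T k @^-1` A) = m A.
  apply/eqP; rewrite eq_le m_shift_le /=.
  have := m_shift_le k^-1%g (T k @^-1` A); congr (m _ <= _).
  by apply/funext => x; rewrite /preimage /= (gtds_actVK T_gtds).
have [mu [muK muT]] := measure_of_mean (gtds_compact T_gtds) m_ge0 mT mU.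
exists mu; split.
  move=> g A _; apply: (muT _ (T g^-1%g)).
  - exact: gtds_actK.
  - exact: gtds_actVK.
  - exact: (@gtds_continuous _ _ _ _ T_gtds).
  - exact: (@gtds_continuous _ _ _ _ T_gtds).
  - exact: m_shift.
apply: lt_le_trans (muK _ cK); rewrite lte_fin (lt_le_trans a0)//.
apply: (ler_cvg_to (cvg_cst a) (mP K)); exact: ooU.
Qed.

End InvariantMean.

(** * Countable mixtures of probabilities *)

Section CountableMixture.
Variables (R : realType) (d : measure_display) (Y : measurableType d).
Variable mu_ : nat -> probability Y R.

Let weight_ge0 n : 0 <= 1 / (2 ^ (n + 1))%:R :> R.
Proof. by []. Qed.

Definition mixture : set Y -> \bar R :=
  mseries (fun n => mscale (NngNum (weight_ge0 n)) (mu_ n)) 0.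

HB.instance Definition _ := Measure.on mixture.

Let mixtureE A : mixture A =
  (\sum_(n <oo) ((1 / (2 ^ (n + 1))%:R)%:E * mu_ n A))%E.
Proof. by []. Qed.

Let mixtureT : mixture setT = 1%E.
Proof.
rewrite mixtureE; under eq_eseriesr do rewrite probability_setT mule1.
by rewrite (cvg_lim _ (@cvg_geometric_eseries_half R 1 0))// expr0 divr1.
Qed.

HB.instance Definition _ := Measure_isProbability.Build _ Y R mixture mixtureT.

(** A single probability charging all the sets that some mu_ n charges, with
    the symmetries common to the mu_ n. *)
Lemma countable_mixture : exists mu : probability Y R,
  (forall A B, (forall n, mu_ n A = mu_ n B) -> mu A = mu B) /\
  (forall n A, (0 < mu_ n A)%E -> (0 < mu A)%E).
Proof.
exists (mixture : probability Y R); split.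
  by move=> A B AB; rewrite /= !mixtureE; apply: eq_eseriesr => n _; rewrite AB.
move=> n A muA; rewrite /= mixtureE.
apply: (@lt_le_trans _ _ ((1 / (2 ^ (n + 1))%:R)%:E * mu_ n A)%E).
  by rewrite mule_gt0// lte_fin divr_gt0// ltr0n expn_gt0.
rewrite (@nneseriesD1 _ _ n)//; last first.
  by move=> k _; rewrite mule_ge0.
rewrite leeDl//; apply: nneseries_ge0 => k _ _; by rewrite mule_ge0.
Qed.

End CountableMixture.

(** * Entropy pairs *)

Section ClosedNeighbourhoods.
Variables (R : realType) (X : pmetricType R).

Lemma closure_ball_lt (x p : X) (r : R) : 0 < r -> closure (ball x r) p ->
  mdist x p < 2 * r.
Proof.
move=> r0 /(_ _ (nbhsx_ballx p _ r0))[q []]; rewrite !ballEmdist /= => xq pq.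
rewrite (le_lt_trans (metric_triangle _ q _))// (metric_sym q p); lra.
Qed.

Lemma closed_nbhs_closure_ball (x : X) (r : R) : 0 < r ->
  closed_nbhs x (closure (ball x r)).
Proof.
move=> r0; split; first exact: closed_closure.
exact: filterS (@subset_closure _ _) (nbhsx_ballx _ _ r0).
Qed.

Lemma closure_ball_disjoint (x y : X) (r s : R) : 0 < r -> 0 < s ->
  2 * r + 2 * s <= mdist x y -> closure (ball x r) `&` closure (ball y s) = set0.
Proof.
move=> r0 s0 xy; rewrite -subset0 => p [/(closure_ball_lt r0) xp].
move=> /(closure_ball_lt s0) yp.
have := metric_triangle x p y; rewrite (metric_sym p y); lra.
Qed.

End ClosedNeighbourhoods.

Section EntropyPairs.
Variables (R : realType) (G : groupType) (X : pmetricType R) (T : G -> X -> X).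
Variable F : nat -> {fset G}.
Hypotheses (folnerF : folner R F) (T_gtds : gtds T).

Lemma entropy_pair_sym x y :
  entropy_pairs T F (x, y) -> entropy_pairs T F (y, x).
Proof.
move=> [xy h]; split=> [yx|Uy Ux nUy nUx Uyx]; first by apply: xy.
by rewrite setUC; apply: h => //; rewrite setIC.
Qed.

Lemma entropy_pair_htop_gt0 x y r s : entropy_pairs T F (x, y) ->
  0 < r -> 0 < s -> 2 * r + 2 * s <= mdist x y ->
  0 < htop T F [set ~` closure (ball x r); ~` closure (ball y s)].
Proof.
move=> [_ h] r0 s0 rs; apply: h; rewrite /=; try exact: closed_nbhs_closure_ball.
exact: closure_ball_disjoint.
Qed.

Lemma entropy_pair_mdist_gt0 x y : entropy_pairs T F (x, y) -> 0 < mdist x y.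
Proof. by move=> [/= xy _]; rewrite mdist_gt0; apply/eqP. Qed.

Lemma entropy_pair_closure x y (e : R) : potp T -> entropy_pairs T F (x, y) ->
  0 < e -> closure (eps_asymptotic_pairs T e) (x, y).
Proof.
move=> T_potp exy e0; have xy0 := entropy_pair_mdist_gt0 exy.
move=> B [[V W] [/= /nbhs_ballP[rV /= rV0 xV] /nbhs_ballP[rW /= rW0 yW]] VWB].
pose rho := Num.min rV rW.
have rho0 : 0 < rho by rewrite lt_min rV0.
pose r := Num.min (rho / 4) (mdist x y / 4).
have r0 : 0 < r by rewrite lt_min !divr_gt0.
have r_rho : r <= rho / 4 by rewrite ge_min lexx.
have r_xy : r <= mdist x y / 4 by rewrite ge_min lexx orbT.
have rr : 2 * r + 2 * r <= mdist x y by lra.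
have h := entropy_pair_htop_gt0 exy r0 r0 rr.
have dis := closure_ball_disjoint r0 r0 rr.
have e'0 : 0 < Num.min e (rho / 4) by rewrite lt_min e0 divr_gt0.
have [p [q [[K pq] Up [q0 Uq0 qq0]]]] :=
  entropy_asymptotic T_gtds folnerF dis h T_potp e'0.
exists (p, q); split.
  by exists K => g gK; rewrite (le_trans (pq g gK))// ge_min lexx.
apply: VWB; split => /=.
  apply: xV; rewrite ballEmdist /= (lt_le_trans (closure_ball_lt r0 Up))//.
  have : rho <= rV by rewrite ge_min lexx.
  lra.
apply: yW; rewrite ballEmdist /=.
have := closure_ball_lt r0 Uq0.
have : rho <= rW by rewrite ge_min lexx orbT.
have : mdist q q0 <= rho / 4 by rewrite (le_trans qq0)// ge_min lexx orbT.
have := metric_triangle y q0 q; rewrite (metric_sym q0 q); lra.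
Qed.

(** A point is in the support as soon as the balls of radius r n around it are
    charged, and one measure per radius suffices, by mixing. The neighbourhood
    of y stays the same, away from all these balls. *)
Lemma entropy_pair_support x y : entropy_pairs T F (x, y) ->
  exists mu : probability (borel X) R, invariant_measure T mu /\ measure_support mu x.
Proof.
move=> exy; have xy0 := entropy_pair_mdist_gt0 exy.
pose r n : R := mdist x y / 4 / n.+1%:R.
have r0 n : 0 < r n by rewrite !divr_gt0.
have r_le n : r n <= mdist x y / 4.
  by rewrite ler_pdivrMr// ler_peMr ?divr_ge0 ?ler1n// ltW.
have /choice[mu_ muP] : forall n, exists mu : probability (borel X) R,
    invariant_measure T mu /\ (0 < mu (closure (ball x (r n))))%E.
  move=> n; have s0 : 0 < mdist x y / 4 by rewrite divr_gt0.
  have rs : 2 * r n + 2 * (mdist x y / 4) <= mdist x y by have := r_le n; lra.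
  have h := entropy_pair_htop_gt0 exy (r0 n) s0 rs.
  have dis := closure_ball_disjoint (r0 n) s0 rs.
  have [a a0 ev] := entropy_visits T_gtds folnerF dis h.
  pose good k z := a * #|` F k|%:R <=
    #|` [fset g in F k | `[< closure (ball x (r n)) (T g z) >]]%fset|%:R.
  have /choice[z zP] : forall k, exists z, (exists z, good k z) -> good k z.
    move=> k; have [[z gz]|no] := pselect (exists z, good k z); first by exists z.
    by exists point.
  apply: (visits_invariant_measure T_gtds folnerF (z := z) a0).
    exact: closed_closure.
  apply: filterS ev => k /zP gz.
  by rewrite /visit_freq ler_pdivlMr ?folner_card_gt0.
have [mu [mu_eq mu_gt0]] := countable_mixture mu_.
exists mu; split.
  by move=> g A mA; apply: mu_eq => n; exact: (muP n).1.
move=> U oU Ux; have /nbhs_ballP[rU /= rU0 xU] : nbhs x U by exact: open_nbhs_nbhs.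
have [n rn] : exists n, 2 * r n < rU.
  exists (Num.truncn (mdist x y / rU)).
  rewrite /r mulrA ltr_pdivrMr//.
  have := truncnS_gt (mdist x y / rU); rewrite ltr_pdivrMr//.
  rewrite mulrC; lra.
apply: lt_le_trans (mu_gt0 n _ (muP n).2) _.
apply: le_measure; rewrite ?inE.
- rewrite -[closure _]setCK; apply: measurableC; apply: open_measurable_borel.
  exact/closed_openC/closed_closure.
- exact: open_measurable_borel.
- move=> p /(closure_ball_lt (r0 n)) xp; apply: xU.
  by rewrite ballEmdist /=; exact: lt_trans rn.
Qed.

Lemma entropy_pair_measure x y : entropy_pairs T F (x, y) ->
  exists mu : probability (borel X) R,
    [/\ invariant_measure T mu, measure_support mu x & measure_support mu y].
Proof.
move=> exy; have [mu [muT mux]] := entropy_pair_support exy.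
have [nu [nuT nuy]] := entropy_pair_support (entropy_pair_sym exy).
have [la [la_eq la_gt0]] := countable_mixture (fun n => if n is 0%N then mu else nu).
exists la; split.
- move=> g A mA; apply: la_eq => -[|_]; [exact: muT | exact: nuT].
- by move=> U oU Ux; apply: (la_gt0 0%N); exact: mux.
- by move=> U oU Uy; apply: (la_gt0 1%N); exact: nuy.
Qed.

End EntropyPairs.

Theorem theorem4p2 (R : realType) (G : groupType) (X : pmetricType R)
    (T : G -> X -> X) (F : nat -> {fset G}) :
  countable [set: G] -> folner R F -> gtds T -> potp T ->
  (forall x y : X, entropy_pairs T F (x, y) ->
     (forall e : R, 0 < e ->
        (closure (eps_asymptotic_pairs T e) `\` diagonal) (x, y)) /\
     (exists mu : probability (borel X) R,
        [/\ invariant_measure T mu, measure_support mu x & measure_support mu y])) /\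
  (forall x y : X, asymptotic_pairs T (x, y) ->
     (exists mu : probability (borel X) R,
        [/\ invariant_measure T mu, measure_support mu x & measure_support mu y]) ->
     (entropy_pairs T F `|` diagonal) (x, y)).
Proof.
move=> _ folnerF T_gtds T_potp; split.
  move=> x y exy; split; last exact: entropy_pair_measure exy.
  move=> e e0; split; first exact: (entropy_pair_closure folnerF T_gtds T_potp exy e0).
  by move=> xy; apply: exy.1; exact: xy.
move=> x y asym [mu [muT mux _]].
have [xy|xy] := pselect (x = y); first by right.
left; split => // Ux Uy [_ xUx] [_ yUy] Uxy.
exact: (asymptotic_entropy T_gtds folnerF T_potp muT mux asym xUx yUy Uxy).
Qed.
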